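(* Let $C$ be a geometrically integral smooth projective curve of genus $g$ over a field $k$ with a finite morphism $\pi:C\to\mathbb P^1$ of degree $n\ge2$, and let $K=k(t)$ be the function field of $\mathbb P^1$. Suppose every finite extension of $K$ has extensions of every degree, and suppose $n=p^k$ with $p$ prime and $k\ge1$, or $n=pq$ with $p,q$ distinct primes, or $n=12$. Then $\mathbf x_{(C,\pi)}\in\bigcup_{\mathfrak T}\mathrm{Len}(\mathfrak T)$, where $\mathfrak T$ ranges over tower types of degree $n$.
   Context: $a_0\le\dots\le a_{n-1}$ are the unique integers with $\pi_*\mathcal O_C\simeq\bigoplus_i\mathcal O_{\mathbb P^1}(-a_i)$, and $\mathbf x_{(C,\pi)}=\big(\frac{a_1}{2(g+n-1)},\dots,\frac{a_{n-1}}{2(g+n-1)}\big)$. A tower type is a tuple $(n_1,\dots,n_t)$ of integers $>1$ with degree $\prod n_s$. Mixed radix: $m=m_1+m_2n_1+\dots+m_tn_1\cdots n_{t-1}$ with $0\le m_s<n_s$; the addition $i+j=k$ does not overflow modulo $\mathfrak T$ if $i_s+j_s=k_s$ for all $s$. $\mathrm{Len}(\mathfrak T)$ is the set of $\mathbf x\in\mathbb R^{n-1}$ with $\sum x_i=1/2$, $0\le x_1\le\dots\le x_{n-1}$, and $x_{i+j}\le x_i+x_j$ whenever $i,j\ge1$, $i+j<n$ and $i+j$ does not overflow modulo $\mathfrak T$. *)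

(* Defs.v *)
From HB Require Import structures.
From mathcomp Require Import all_boot all_order all_algebra all_field.
From mathcomp Require Import classical_sets reals.

Set Implicit Arguments.
Unset Strict Implicit.
Unset Printing Implicit Defensive.

Import Order.TTheory GRing.Theory Num.Theory.
Local Open Scope ring_scope.
Local Open Scope classical_set_scope.

(* P^1 over k is glued from Spec k[t] and Spec k[s] along s = 1/t.  A scheme  *)
(* C with a finite morphism pi : C -> P^1 is the same thing as the preimages  *)
(* Spec A0, Spec A1 of these two charts, where A0 is a finite k[t]-algebra    *)
(* and A1 a finite k[s]-algebra, together with their intersection Spec A01,   *)
(* which is the locus t != 0 in Spec A0 and the locus s != 0 in Spec A1.      *)
(* A k[t]-algebra is a k-algebra with a chosen element (the image of t).      *)
(* Such a C is automatically projective over k.  As algebra types are         *)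
(* nontrivial, pi is not constant with value t = 0 or t = infinity.           *)

Definition is_localization (k : fieldType) (A B : comAlgType k)
    (u : A) (rho : {lrmorphism A -> B}) : Prop :=
  [/\ exists v, rho u * v = 1,
      forall y, exists a m, rho u ^+ m * y = rho a
    & forall a, rho a = 0 -> exists m, u ^+ m * a = 0].

(* The polynomial p acts on A as multiplication by p(u). *)
Definition is_finite_over (k : fieldType) (A : comAlgType k) (u : A) : Prop :=
  exists (r : nat) (e : 'I_r -> A), forall a, exists p : 'I_r -> {poly k},
    a = \sum_(i < r) horner_alg u (p i) * e i.

Record P1_cover (k : fieldType) := P1Cover {
  chart0 : comAlgType k;
  chart1 : comAlgType k;
  overlap : comAlgType k;
  param0 : chart0;
  param1 : chart1;
  res0 : {lrmorphism chart0 -> overlap};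
  res1 : {lrmorphism chart1 -> overlap};
  res_paramK : res0 param0 * res1 param1 = 1;
  chart0_finite : is_finite_over param0;
  chart1_finite : is_finite_over param1;
  res0_loc : is_localization param0 res0;
  res1_loc : is_localization param1 res1
}.

Section BaseChange.
Variables (k k' : fieldType) (iota : {rmorphism k -> k'}).

(* f exhibits B as the tensor product of A and k' over k. *)
Definition is_base_change (A : comAlgType k) (B : comAlgType k')
    (f : {lrmorphism A -> B | iota \; *:%R}) : Prop :=
  forall (D : comAlgType k') (g : {lrmorphism A -> D | iota \; *:%R}),
    exists h : {lrmorphism B -> D}, h \o f =1 g /\
      forall h' : {lrmorphism B -> D}, h' \o f =1 g -> h' =1 h.

End BaseChange.

Definition geom_integral_alg (k : fieldType) (A : comAlgType k) : Prop :=
  forall (k' : fieldType) (iota : {rmorphism k -> k'}) (B : comAlgType k')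
    (f : {lrmorphism A -> B | iota \; *:%R}), is_base_change f ->
    forall x y : B, x * y = 0 -> x = 0 \/ y = 0.

(* The charts meet, also after base change, since overlap is nontrivial; so   *)
(* integrality can be tested on the two charts.                               *)
Definition geom_integral (k : fieldType) (C : P1_cover k) : Prop :=
  geom_integral_alg (chart0 C) /\ geom_integral_alg (chart1 C).

(* Infinitesimal lifting along square-zero thickenings.  For algebras of      *)
(* finite presentation over k, such as the charts of a P1_cover, this is      *)
(* smoothness (EGA IV 17.3.1).                                                *)
Definition formally_smooth (k : fieldType) (A : comAlgType k) : Prop :=
  forall (B B' : comAlgType k) (q : {lrmorphism B -> B'}),
    (forall y, exists x, q x = y) ->
    (forall x y, q x = 0 -> q y = 0 -> x * y = 0) ->
    forall f : {lrmorphism A -> B'},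
      exists g : {lrmorphism A -> B}, q \o g =1 f.

Definition smooth (k : fieldType) (C : P1_cover k) : Prop :=
  formally_smooth (chart0 C) /\ formally_smooth (chart1 C).

Definition ratfun (k : fieldType) : fieldType := {fraction {poly k}}.

(* The function field of an integral C, as an extension of k(t) through pi.   *)
Definition is_function_field (k : fieldType) (C : P1_cover k)
    (L : fieldExtType (ratfun k)) (phi : {rmorphism chart0 C -> L}) : Prop :=
  [/\ injective phi,
      forall p : {poly k},
        phi (horner_alg (param0 C) p) = (tofrac p : ratfun k)%:A
    & forall z : L, exists a b, phi b != 0 /\ z = phi a / phi b].

Definition has_degree (k : fieldType) (C : P1_cover k) (n : nat) : Prop :=
  exists (L : fieldExtType (ratfun k)) (phi : {rmorphism chart0 C -> L}),
    is_function_field phi /\ \dim {:L} = n.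

(* g = dim H^1(C, O_C), computed as the Cech cohomology group                 *)
(* A01 / (A0 + A1) of the affine cover; b is a basis of this quotient.        *)
Definition has_genus (k : fieldType) (C : P1_cover k) (g : nat) : Prop :=
  exists b : 'I_g -> overlap C, forall y : overlap C,
    exists! c : {ffun 'I_g -> k}, exists a0 a1,
      y = \sum_(i < g) c i *: b i + (res0 C a0 - res1 C a1).

Definition is_poly_basis (k : fieldType) (A : comAlgType k) (u : A)
    (n : nat) (e : 'I_n -> A) : Prop :=
  forall a, exists! p : {ffun 'I_n -> {poly k}},
    a = \sum_(i < n) horner_alg u (p i) * e i.

Definition param_exp (k : fieldType) (C : P1_cover k) (m : int) : overlap C :=
  match m with
  | Posz d => res0 C (param0 C) ^+ d
  | Negz d => res1 C (param1 C) ^+ d.+1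
  end.

(* O(-a) is free on a generator e over k[t] and on a generator f over k[s],   *)
(* with f = t^(-a) e on the overlap: O(d) has the sections e, t e, ..., t^d e *)
(* for d >= 0.  An isomorphism from the sum of the O(-a_i) to pi_* O_C is     *)
(* given by the images of these generators.                                   *)
Definition pushforward_splits (k : fieldType) (C : P1_cover k)
    (n : nat) (a : n.-tuple int) : Prop :=
  exists (e : 'I_n -> chart0 C) (f : 'I_n -> chart1 C),
    [/\ is_poly_basis (param0 C) e,
        is_poly_basis (param1 C) f
      & forall i, res1 C (f i) = param_exp C (- tnth a i) * res0 C (e i)].

(* The scrollar invariants a_0 <= ... <= a_(n-1). *)
Definition is_scrollar (k : fieldType) (C : P1_cover k)
    (n : nat) (a : n.-tuple int) : Prop :=
  sorted <=%R a /\ pushforward_splits C a.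

Definition has_all_degrees (F : fieldType) : Prop :=
  forall (E : fieldExtType F) (d : nat), (0 < d)%N ->
    exists M : fieldExtType E, \dim {:M} = d.

(* Coordinates are numbered from 1 in x_1, ..., x_(n-1) but from 0 in 'rV, so *)
(* x_(i+1) is the entry x 0 i.                                                *)
Definition scrollar_point (R : realType) (g n : nat) (a : n.-tuple int) :
    'rV[R]_n.-1 :=
  \row_(i < n.-1) ((a`_i.+1)%:~R / (2 * (g + n - 1))%N%:R).

Definition tower_type (n : nat) (T : seq nat) : Prop :=
  all (fun m => 1 < m)%N T /\ (\prod_(m <- T) m = n)%N.

Definition mixed_radix (T : seq nat) (m : nat) (d : seq nat) : Prop :=
  [/\ size d = size T,
      forall s, (s < size T)%N -> (nth 0 d s < nth 0 T s)%N
    & m = (\sum_(0 <= s < size T)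
             nth 0 d s * \prod_(0 <= r < s) nth 0 T r)%N].

Definition no_overflow (T : seq nat) (i j : nat) : Prop :=
  exists di dj dk : seq nat,
    [/\ mixed_radix T i di, mixed_radix T j dj, mixed_radix T (i + j) dk
      & forall s, (s < size T)%N -> (nth 0 di s + nth 0 dj s = nth 0 dk s)%N].

Definition Len (R : realType) (n : nat) (T : seq nat) : set 'rV[R]_n.-1 :=
  [set x | [/\ \sum_(i < n.-1) x 0 i = 2^-1,
     forall i, 0 <= x 0 i,
     forall i j : 'I_n.-1, (i <= j)%N -> x 0 i <= x 0 j
   & forall i j l : 'I_n.-1, l.+1 = (i.+1 + j.+1)%N ->
       no_overflow T i.+1 j.+1 -> x 0 l <= x 0 i + x 0 j]].

Arguments Len R n T : clear implicits.
Arguments scrollar_point R g {n} a.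

(* Main.v *)
(* Let F_i be the span over K = k(t) of the first i + 1 elements of a basis    *)
(* of pi_* O_C ordered by scrollar invariant.  If a_(i+j) > a_i + a_j, then    *)
(* F_i F_j lies in F_(i+j-1) and so has dimension at most                      *)
(* dim F_i + dim F_j - 2.  By Kneser's theorem for the extension L/K it is     *)
(* stable under a subfield H, and comparing dimensions over H shows that the   *)
(* addition i + j carries at h = [H : K], that is, i mod h + j mod h >= h.     *)
(* It remains to find a tower type such that each of these pairs carries at    *)
(* one of its partial products.  For n = p^k the type (p, ..., p) works.       *)
(* Otherwise, the inequality                                                   *)
(* dim W * dim (H H') <= dim (W H) * dim (W H') restricts how a pair with      *)
(* stabilizer H and a pair with stabilizer H' can coexist: for n = pq all the  *)
(* stabilizers have the same degree, and for n = 12 a finite check leaves one  *)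
(* of (2,2,3), (2,3,2), (3,2,2).                                               *)
(* Kneser's theorem holds without separability: Dyson's transform gives, for   *)
(* each a in A, a subspace of AB containing aB and stable under a large        *)
(* subfield, and sums of such subspaces are controlled by the same inequality. *)
(* The coordinates sum to 1/2 because H^0(O_C) = k and, by Cech cohomology,    *)
(* g is the sum of the max(0, a_i - 1).                                        *)

Require Import Defs.
From HB Require Import structures.
From mathcomp Require Import all_boot all_order all_algebra all_field.
From mathcomp Require Import classical_sets reals boolp zify.

Set Implicit Arguments.
Unset Strict Implicit.

Import Order.TTheory GRing.Theory Num.Theory.
Local Open Scope ring_scope.

(** * Kneser's theorem for field extensions *)

(** A failure of x_(i+j) <= x_i + x_j is a statement about small products: by
    [structure_constant_eq0], F_i F_j then lies in F_(i+j-1), so its dimension is at most dim F_i +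
    dim F_j - 2. By [kneser_stabilizer] it has a nontrivial stabilizer H; rounding to multiples of h
    = [H : K] leaves no slack, so all bounds are equalities and i + j carries modulo h ([tightP]).
    An addition without overflow carries at no partial product of the tower ([no_overflow_modn]), so
    one tower catching all the failing pairs suffices ([flag_tower_type]).

    The linear triangle inequality [dim_prodv_triangle] is used twice. It controls sums of spaces
    stable under different subfields ([dim_add_modules]), which is the heart of Kneser's theorem,
    and it bounds the overlap of the spaces of two failing pairs ([dim_cap_modules]), which settles
    n = pq and reduces n = 12 to [incompatible12].

    The other conditions are geometric. Comparing poles at infinity ([coef_comb_bound]) gives a_0 =
    0; geometric integrality makes global sections constant, so the other a_i are positive; counting
    Cech monomials gives g as the sum of the a_i - 1 for i > 0. *)

Section Triangle.
Context {F : fieldType} {L : fieldExtType F}.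
Implicit Types (A B C P Q U V W X Z : {vspace L}) (H : {subfield L}) (v : L).

Lemma dimv_leq_sum_cap U V W Q : (U <= W)%VS -> (V <= W)%VS ->
  (U :&: V <= Q)%VS -> (\dim U + \dim V <= \dim W + \dim Q)%N.
Proof.
move=> UW VW UVQ; rewrite -dimv_sum_cap leq_add ?dimvS //.
by rewrite subv_add UW.
Qed.

Lemma dimv_leq_prodv U V : U != 0%VS -> (\dim V <= \dim (U * V))%N.
Proof.
rewrite -vpick0 => u0; rewrite -(dim_cosetv V u0) prodvC dimvS // prodvSl //.
by rewrite -memvE memv_pick.
Qed.

(** Induction on a spanning family of C. When c is adjoined, with Y the intersection of X c and X C,
    the space X C grows by dim X - dim Y and X B C by at most dim (X B) - dim (Y B). Minimality for
    Y / c, a subspace of X, bounds dim (Y B) below in proportion to dim Y. *)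
Lemma dim_prodv_minimal_ratio B X C :
  (forall Z, (Z <= X)%VS ->
     (\dim (X * B) * \dim Z <= \dim (Z * B) * \dim X)%N) ->
  (\dim (X * B * C) * \dim X <= \dim (X * B) * \dim (X * C))%N.
Proof.
move=> minX; rewrite -(span_basis (vbasisP C)).
elim: {C}(vbasis C : seq L) => [|c s IHs].
  by rewrite span_nil !prodv0 dimv0.
rewrite span_cons; set C := <<s>>%VS in IHs *.
have [-> | c0] := eqVneq c 0; first by rewrite !add0v.
pose Y := (X * <[c]> :&: X * C)%VS; pose Z := (Y * <[c^-1]>)%VS.
have dimZ : \dim Z = \dim Y by rewrite dim_cosetv ?invr_eq0.
have cK U : (U * <[c]> * <[c^-1]>)%VS = U.
  by rewrite -prodvA prodv_line divff // prodv1.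
have leZX : (Z <= X)%VS by rewrite -[X]cK prodvSl // capvSl.
have YBle : (Y * B <= X * B * <[c]> :&: X * B * C)%VS.
  by rewrite subv_cap ![(X * B * _)%VS]prodvAC !prodvSl // ?capvSl ?capvSr.
have := minX _ leZX.
rewrite dimZ /Z prodvAC dim_cosetv ?invr_eq0 // => minZ.
have D1 := dimv_sum_cap (X * <[c]>) (X * C).
have D2 := dimv_sum_cap (X * B * <[c]>) (X * B * C).
rewrite -!prodvDr !dim_cosetv // in D1 D2.
have D3 := dimvS YBle.
rewrite -/Y in D1; move: D1 D2 D3 IHs minZ.
suff aux (p q e f y cb yb e' f' : nat) : (f' + y = q + f)%N ->
    (e' + cb = p + e)%N -> (yb <= cb)%N -> (e * q <= p * f)%N ->
    (p * y <= yb * q)%N -> (e' * q <= p * f')%N by exact: aux.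
by move=> D1 D2 D3; have := leq_mul D3 (leqnn q); nia.
Qed.

(* A linear form of the Ruzsa triangle inequality, by Petridis' argument: pass *)
(* to the subspace X of W with the least ratio dim (X * B) / dim X.            *)
Lemma dim_prodv_triangle W B C : W != 0%VS ->
  (\dim W * \dim (B * C) <= \dim (W * B) * \dim (W * C))%N.
Proof.
move=> W0.
suff [X [X0 XW ratX minX]] : exists X, [/\ X != 0%VS, (X <= W)%VS,
    (\dim (X * B) * \dim W <= \dim (W * B) * \dim X)%N
  & forall Z, (Z <= X)%VS ->
     (\dim (X * B) * \dim Z <= \dim (Z * B) * \dim X)%N].
  have := dim_prodv_minimal_ratio C minX; rewrite -prodvA.
  have := dimv_leq_prodv (B * C) X0.
  have := dimvS (prodvSl C XW); have : (0 < \dim X)%N by rewrite lt0n dimv_eq0.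
  move: ratX.
  suff aux (x y z w r t u v : nat) : (y * w <= r * x)%N -> (0 < x)%N ->
    (z <= t)%N -> (u <= v)%N -> (v * x <= y * z)%N -> (w * u <= r * t)%N.
    exact: aux.
  move=> ywrx x0 zt uv vxyz; rewrite -(leq_pmul2r x0).
  apply: (@leq_trans (w * (y * z))).
    by rewrite -mulnA leq_mul2l (leq_trans _ vxyz) ?orbT // leq_mul2r uv orbT.
  by rewrite mulnA [(w * y)%N]mulnC [leqRHS]mulnAC leq_mul.
elim: {W}_.+1 {-2}W (ltnSn (\dim W)) W0 => // n IHn W; rewrite ltnS => leWn W0.
(* Either W itself has the least ratio, or some Z inside it does strictly better; then dim Z < dim W
   and induction applies to Z. *)
have [minW | ] := pselect (forall Z, (Z <= W)%VS ->
     (\dim (W * B) * \dim Z <= \dim (Z * B) * \dim W)%N).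
  by exists W; split.
move/existsNP=> [Z /not_implyP[ZW /negP]]; rewrite -ltnNge => ltZW.
have Z0 : Z != 0%VS by apply: contraTneq ltZW => ->; rewrite dimv0 muln0.
have dZW : (\dim Z < \dim W)%N.
  rewrite ltn_neqAle dimvS // andbT; apply: contraTneq ltZW => eqd.
  have/eqP-> : Z == W by rewrite eqEdim ZW eqd /=.
  by rewrite ltnn.
have [X [X0 XZ ratX minX]] := IHn _ (leq_trans dZW leWn) Z0.
exists X; split=> //; first exact: subv_trans ZW.
have z0 : (0 < \dim Z)%N by rewrite lt0n dimv_eq0.
move: ratX (ltnW ltZW) z0.
suff aux (x y z w r t : nat) : (y * z <= t * x)%N -> (t * w <= r * z)%N ->
  (0 < z)%N -> (y * w <= r * x)%N by exact: aux.
move=> yztx twrz z0; rewrite -(leq_pmul2r z0).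
have := leq_mul yztx (leqnn w); have := leq_mul twrz (leqnn x); nia.
Qed.
End Triangle.

(** * Subspaces stable under subfields, and duality *)

Section Modules.
Context {F : fieldType} {L : fieldExtType F}.
Implicit Types (A B C N P Q U V W X Z : {vspace L}) (H M : {subfield L}) (v : L).

Section Orthogonal.
Variable tau : {linear L -> F^o}.

Definition perpv_map k (u : 'I_k -> L) (c : L) : 'rV[F]_k :=
  \row_(i < k) (tau (c * u i) : F).

Fact perpv_map_is_linear k (u : 'I_k -> L) : linear (perpv_map u).
Proof.
move=> a x y; apply/rowP => i; rewrite !mxE mulrDl -scalerAl.
by rewrite linearP.
Qed.

HB.instance Definition _ k u := GRing.isLinear.Build F L 'rV[F]_k _
  (perpv_map u) (@perpv_map_is_linear k u).

(** The orthogonal of U for the form (c, u) |-> tau (c u), as the kernel of a map to dim U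
    coordinates, so that rank-nullity bounds its codimension. *)
Definition perpv U : {vspace L} :=
  lker (linfun (perpv_map (fun i : 'I_(\dim U) => (vbasis U)`_i))).

Lemma perpvP U c : reflect (forall u, u \in U -> tau (c * u) = 0) (c \in perpv U).
Proof.
rewrite memv_ker lfunE /=; apply: (iffP eqP) => [/rowP c0 u uU | c0].
  rewrite (coord_vbasis uU) mulr_sumr linear_sum big1 // => i _.
  by rewrite -scalerAr linearZ /=; have := c0 i; rewrite !mxE => ->; rewrite scaler0.
by apply/rowP => i; rewrite !mxE c0 // vbasis_mem // mem_nth ?size_tuple.
Qed.

Lemma dim_perpv_geq V U : (\dim V <= \dim (V :&: perpv U) + \dim U)%N.
Proof.
rewrite -(limg_ker_dim (linfun (perpv_map (fun i : 'I_(\dim U) => (vbasis U)`_i))) V).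
rewrite leq_add2l; apply: leq_trans (dimvS (subvf _)) _.
by rewrite dimvf /dim /= mul1n.
Qed.
End Orthogonal.

Lemma module_cap H U V : (H * U <= U)%VS -> (H * V <= V)%VS ->
  (H * (U :&: V) <= U :&: V)%VS.
Proof.
move=> HU HV; rewrite subv_cap (subv_trans _ HU) ?prodvSr ?capvSl //.
by rewrite (subv_trans _ HV) ?prodvSr ?capvSr.
Qed.

Lemma module_line H V z : (H * V <= V)%VS -> z \in V -> (H * <[z]> <= V)%VS.
Proof. by move=> HV zV; rewrite (subv_trans _ HV) // prodvSr // -memvE. Qed.

Lemma mem_coset_line U z x : z != 0 -> (x \in U * <[z]>)%VS = (x / z \in U).
Proof.
move=> z0; apply/idP/idP => [|xz].
  rewrite memvE => /(prodvSl <[z^-1]>); rewrite -prodvA !prodv_line divff //.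
  by rewrite prodv1 -memvE.
by rewrite -[x](divfK z0) memv_mul // memv_line.
Qed.

Lemma module_eq_line H V z : (H * V <= V)%VS -> z \in V -> z != 0 ->
  \dim V = \dim H -> V = (H * <[z]>)%VS.
Proof.
move=> HV zV z0 dV; apply/eqP; rewrite eq_sym eqEdim module_line //=.
by rewrite dim_cosetv // dV.
Qed.

Lemma cap_coset_line (H1 H2 : {subfield L}) z : z != 0 ->
  \dim (H1 * <[z]> :&: H2 * <[z]>) = \dim (H1 :&: H2).
Proof.
move=> z0; rewrite -[RHS](dim_cosetv _ z0); congr (\dim _).
apply/vspaceP => x; rewrite memv_cap !mem_coset_line //.
by rewrite memv_cap.
Qed.

Lemma perpv_module tau H V : (H * V <= V)%VS -> (H * perpv tau V <= perpv tau V)%VS.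
Proof.
move=> HV; apply/prodvP => h c hH /perpvP cV; apply/perpvP => u uV.
by rewrite mulrC mulrA mulrC cV // mulrC (subvP HV) // memv_mul.
Qed.

(* The functionals on the line M v over M which vanish on a hyperplane over H_i *)
(* form a line over H_i; those vanishing on P + Q lie in both lines.          *)
Lemma codim_add_hyperplanes (H1 H2 M : {subfield L}) P Q v : v != 0 ->
  (H1 <= M)%VS -> (H2 <= M)%VS ->
  (H1 * P <= P)%VS -> (H2 * Q <= Q)%VS ->
  (P <= M * <[v]>)%VS -> (Q <= M * <[v]>)%VS ->
  (\dim P + \dim H1 = \dim M)%N -> (\dim Q + \dim H2 = \dim M)%N ->
  (\dim M <= \dim (P + Q) + \dim (H1 :&: H2))%N.
Proof.
move=> v0 H1M H2M HP HQ PN QN dP dQ.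
have [tau tauv] : exists tau : {linear L -> F^o}, tau v != 0.
  apply/not_existsP => tau0; case/eqP: v0.
  rewrite (coord_vbasis (memvf v)) big1 // => i _.
  by have /negP/negPn/eqP := tau0 (coord (vbasis {:L}) i); rewrite /= => ->; rewrite scale0r.
(* For z outside R, the hyperplane R and the line H z span M v. A nonzero x in M orthogonal to both
   would give tau v = 0, as x^-1 v lies in M v. So an element of M orthogonal to R is determined by
   its pairing with H z. *)
have dimP H R : (H <= M)%VS -> (H * R <= R)%VS -> (R <= M * <[v]>)%VS ->
    (\dim R + \dim H = \dim M)%N -> (\dim (M :&: perpv tau R) <= \dim H)%N.
  move=> HM HR RN dR.
  have /subvPn[z zN zR] : ~~ (M * <[v]> <= R)%VS.
    apply/negP => /dimvS; rewrite dim_cosetv // -dR -[leqRHS]addn0 leq_add2l.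
    by rewrite leqNgt adim_gt0.
  have z0 : z != 0 by apply: contraNneq zR => ->; rewrite mem0v.
  have RHz : (R :&: H * <[z]> = 0)%VS.
    apply/eqP; rewrite -subv0; apply/subvP => x; rewrite memv_cap memv0.
    case/andP=> xR; rewrite mem_coset_line // => xz.
    apply: contraNT zR => x0; have -> : z = (x / z)^-1 * x.
      by rewrite invf_div divfK.
    by rewrite (subvP HR) // memv_mul // memvV.
  have dRHz : (R + H * <[z]> = M * <[v]>)%VS.
    apply/eqP; rewrite eqEdim subv_add RN /=.
    rewrite dimv_disjoint_sum // !dim_cosetv // dR leqnn andbT.
    rewrite (subv_trans (prodvSl _ HM)) // module_line //.
    by rewrite prodvA prodv_id.
  rewrite -(dim_cosetv H z0).
  apply: leq_trans (dim_perpv_geq tau _ (H * <[z]>)) _.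
  rewrite [X in (\dim X + _)%N](_ : _ = 0%VS) ?dimv0 //.
  apply/eqP; rewrite -subv0; apply/subvP => x; rewrite !memv_cap memv0.
  case/andP=> /andP[xM /perpvP xR] /perpvP xHz; apply: contraNT tauv => x0.
  have : x^-1 * v \in (R + H * <[z]>)%VS.
    by rewrite dRHz memv_mul ?memvV // memv_line.
  case/memv_addP=> r rR [w wHz xv].
  have -> : v = x * r + x * w by rewrite -mulrDr -xv mulVKf.
  by rewrite raddfD /= xR // xHz // addr0.
have := dim_perpv_geq tau M (P + Q); set X := (M :&: _)%VS => dMX.
apply: leq_trans dMX _; rewrite addnC leq_add2l.
have [-> | X0] := eqVneq X 0%VS; first by rewrite dimv0.
have cX := memv_pick X; rewrite -vpick0 in X0; move: (vpick X) cX X0 => c cX c0.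
have perpS H R : (H <= M)%VS -> (H * R <= R)%VS -> (R <= M * <[v]>)%VS ->
    (R <= P + Q)%VS -> (\dim R + \dim H = \dim M)%N -> (X <= H * <[c]>)%VS.
  move=> HM HR RN RPQ dR.
  have XR : (X <= M :&: perpv tau R)%VS.
    rewrite subv_cap capvSl; apply/subvP => x; rewrite memv_cap => /andP[_ /perpvP xPQ].
    by apply/perpvP => u uR; rewrite xPQ // (subvP RPQ).
  have Hc : (H * <[c]> <= M :&: perpv tau R)%VS.
    apply: module_line (subvP XR _ cX); apply: module_cap; last exact: perpv_module.
    by rewrite (subv_trans (prodvSl _ HM)) ?prodv_id.
  rewrite (subv_trans XR) //; suff /eqP-> : (H * <[c]> == M :&: perpv tau R)%VS by [].
  by rewrite eqEdim Hc dim_cosetv // dimP.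
rewrite -(cap_coset_line H1 H2 c0) dimvS // subv_cap (perpS H1 P) ?(perpS H2 Q) ?addvSl ?addvSr //.
Qed.

End Modules.

Section Arithmetic.
Local Open Scope nat_scope.

(** Here p, q, w, m are the dimensions of P, Q, [P :&: Q], M. As m - q = (n2 - y) h2, the difference
    p m - p q = x (n2 - y) h1 h2 is at least m h2. *)
Lemma leq_of_mul_leq_codim w p q m h1 h2 x y n1 n2 : p = x * h1 -> q = y * h2 ->
  m = n1 * h1 -> m = n2 * h2 -> y < n2 -> 0 < m ->
  w * m <= p * q -> n1 <= x * (n2 - y) -> w + h2 <= p.
Proof.
move=> ep eq em1 em2 lty m0 wm n1le; rewrite -(leq_pmul2r m0) mulnDl.
have -> : p * m = p * q + h2 * (x * (n2 - y) * h1) by rewrite ep eq em2; nia.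
by rewrite leq_add // leq_mul // em1 leq_mul.
Qed.

(** With v = n1 - x - 1 and u = n2 - y - 1 the bounds read x u <= v and y v <= u: either u = v = 0
    (two hyperplanes) or x = y = 1 (two lines). *)
Lemma small_mul_codim x y n1 n2 : 0 < x < n1 -> 0 < y < n2 ->
  x * (n2 - y) < n1 -> y * (n1 - x) < n2 ->
  (n1 = x.+1 /\ n2 = y.+1) \/ (x = 1 /\ y = 1).
Proof.
move=> /andP[x0 x1] /andP[y0 y1].
rewrite -(subnKC x1) -(subnKC y1) !addSnnS !addKn.
move: (n1 - _) (n2 - _) => v u hP hQ {n1 n2 x1 y1}.
have xu : x * u <= v by lia.
have yv : y * v <= u by lia.
have [u0|u0] := posnP u; [left|right].
  by have /eqP : v == 0; [move: yv; rewrite u0 leqn0 muln_eq0; lia | lia].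
have v0 : 0 < v by apply: leq_trans xu; rewrite muln_gt0 x0.
have := leq_trans xu (leq_trans (leq_pmull v y0) yv).
have := leq_trans yv (leq_trans (leq_pmull u x0) xu).
by rewrite -{2}[u]mul1n -{2}[v]mul1n !leq_pmul2r // => ? ?; lia.
Qed.

Lemma sum_cap_leq s w p q h d : s + w = p + q -> w + h <= p + d -> q + h <= s + d.
Proof. lia. Qed.

Lemma leq_add_chain v s t q h d : v + s <= t + q -> q + h <= s + d -> v + h <= t + d.
Proof. lia. Qed.

Lemma leq_subS k m n : m - n <= k -> n < m -> m - n.+1 < k.
Proof. lia. Qed.
End Arithmetic.

(** * Sums of stable subspaces and Kneser's theorem *)

Section KneserTheorem.
Context {F : fieldType} {L : fieldExtType F}.
Implicit Types (A B C N P Q U V W X Z : {vspace L}) (H M : {subfield L}) (v : L).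

Lemma subv_prodvl (H1 H2 : {subfield L}) : (H1 <= H1 * H2)%VS.
Proof. by rewrite -{1}[H1 : {vspace L}]prodv1 prodvSr ?sub1v. Qed.

Lemma subv_prodvr (H1 H2 : {subfield L}) : (H2 <= H1 * H2)%VS.
Proof. by rewrite -{1}[H2 : {vspace L}]prod1v prodvSl ?sub1v. Qed.

(** Inside one coset of M = H1 H2, the triangle inequality for a nonzero [P :&: Q] gives dim (P :&:
    Q) dim M <= dim P dim Q. This suffices unless P and Q are both hyperplanes, settled by duality
    in [codim_add_hyperplanes], or both lines, which meet in at most a line over [H1 :&: H2]. *)
Lemma dim_add_submodules (H1 H2 : {subfield L}) P Q v :
  let M := (H1 * H2)%AS in let d := \dim (H1 :&: H2) in v != 0 ->
  (H1 * P <= P)%VS -> (H2 * Q <= Q)%VS ->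
  (P <= M * <[v]>)%VS -> (Q <= M * <[v]>)%VS ->
  P != 0%VS -> Q != 0%VS -> (\dim P < \dim M)%N -> (\dim Q < \dim M)%N ->
  (\dim Q + \dim H2 <= \dim (P + Q) + d)%N \/
  (\dim P + \dim H1 <= \dim (P + Q) + d)%N.
Proof.
move=> M d v0 HP HQ PN QN P0 Q0 ltP ltQ.
have H1M : (H1 <= M)%VS := subv_prodvl H1 H2.
have H2M : (H2 <= M)%VS := subv_prodvr H1 H2.
have DPQ := dimv_sum_cap P Q.
have [W0 | W0] := eqVneq (P :&: Q)%VS 0%VS.
  have Pge : (\dim H1 <= \dim P)%N.
    by apply: leq_trans (dimvS HP); rewrite prodvC dimv_leq_prodv.
  have Qge : (\dim H2 <= \dim Q)%N.
    by apply: leq_trans (dimvS HQ); rewrite prodvC dimv_leq_prodv.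
  have := leq_total (\dim H1) (\dim H2) => /orP[le | le]; [right | left].
    rewrite [(\dim P + \dim Q)%N]addnC in DPQ; apply: (sum_cap_leq DPQ).
    by rewrite W0 dimv0 add0n (leq_trans le) // (leq_trans Qge) ?leq_addr.
  apply: (sum_cap_leq DPQ).
  by rewrite W0 dimv0 add0n (leq_trans le) // (leq_trans Pge) ?leq_addr.
have WM := dim_prodv_triangle H1 H2 W0.
have WP : (\dim ((P :&: Q) * H1) <= \dim P)%N.
  by rewrite prodvC (leq_trans _ (dimvS HP)) // dimvS // prodvSr // capvSl.
have WQ : (\dim ((P :&: Q) * H2) <= \dim Q)%N.
  by rewrite prodvC (leq_trans _ (dimvS HQ)) // dimvS // prodvSr // capvSr.
have WMPQ := leq_trans WM (leq_mul WP WQ).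
have /dvdnP[al dP] := field_module_dimS HP.
have /dvdnP[ga dQ] := field_module_dimS HQ.
have /dvdnP[m1 dM1] := field_dimS H1M.
have /dvdnP[m2 dM2] := field_dimS H2M.
have h1_gt0 := adim_gt0 H1; have h2_gt0 := adim_gt0 H2.
have p0 : (0 < \dim P)%N by rewrite lt0n dimv_eq0.
have q0 : (0 < \dim Q)%N by rewrite lt0n dimv_eq0.
have al0 : (0 < al)%N by move: p0; rewrite dP muln_gt0 => /andP[].
have ga0 : (0 < ga)%N by move: q0; rewrite dQ muln_gt0 => /andP[].
have al1 : (al < m1)%N by move: ltP; rewrite dP dM1 ltn_mul2r => /andP[].
have ga1 : (ga < m2)%N by move: ltQ; rewrite dQ dM2 ltn_mul2r => /andP[].
have M0 : (0 < \dim M)%N by rewrite adim_gt0.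
have [hP|hP] := leqP m1 (al * (m2 - ga)).
  left; apply: (sum_cap_leq DPQ); apply: leq_trans (leq_addr _ _).
  exact: (leq_of_mul_leq_codim dP dQ dM1 dM2).
have [hQ|hQ] := leqP m2 (ga * (m1 - al)).
  rewrite [(\dim P + _)%N]addnC in DPQ; rewrite [(\dim P * _)%N]mulnC in WMPQ.
  right; apply: (sum_cap_leq DPQ); apply: leq_trans (leq_addr _ _).
  exact: (leq_of_mul_leq_codim dQ dP dM2 dM1).
have [||[e1 e2]|[e1 e2]] := small_mul_codim _ _ hP hQ; rewrite ?al0 ?ga0 //.
- have dPM : (\dim P + \dim H1 = \dim M)%N by rewrite dP dM1 e1 mulSnr.
  have dQM : (\dim Q + \dim H2 = \dim M)%N by rewrite dQ dM2 e2 mulSnr.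
  by left; rewrite dQM (codim_add_hyperplanes v0 H1M H2M HP HQ PN QN).
- have WP1 : (\dim (P :&: Q) <= d)%N.
    have zW := memv_pick (P :&: Q); rewrite -vpick0 in W0.
    move: (vpick _) W0 zW => z z0; rewrite memv_cap => /andP[zP zQ].
    rewrite (module_eq_line HP zP z0) ?dP ?e1 ?mul1n //.
    rewrite (module_eq_line HQ zQ z0) ?dQ ?e2 ?mul1n //.
    by rewrite cap_coset_line.
  rewrite e1 e2 !mul1n in dP dQ.
  have := leq_total (\dim H1) (\dim H2) => /orP[le | le]; [right | left].
    rewrite [(\dim P + \dim Q)%N]addnC in DPQ.
    by apply: (sum_cap_leq DPQ); rewrite dQ addnC leq_add.
  by apply: (sum_cap_leq DPQ); rewrite dP addnC leq_add.
Qed.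

(** Passing from V2 to V1 + V2 gains at least as much as passing from Q to P + Q, where P and Q are
    the parts of V1 and V2 in the coset M v. The first alternative is the case Q = 0. *)
Lemma dim_add_modules_at (H1 H2 : {subfield L}) V1 V2 v :
  let d := \dim (H1 :&: H2) in
  (H1 * V1 <= V1)%VS -> (H2 * V2 <= V2)%VS -> v \in V1 -> v \notin V2 ->
  [\/ (\dim V2 + \dim H1 <= \dim (V1 + V2))%N,
      (\dim V2 + \dim H2 <= \dim (V1 + V2) + d)%N
    | (\dim V1 + \dim H1 <= \dim (V1 + V2) + d)%N].
Proof.
move=> d HV1 HV2 vV1 vV2; pose M := (H1 * H2)%AS.
have v0 : v != 0 by apply: contraNneq vV2 => ->; rewrite mem0v.
have H1M : (H1 <= M)%VS := subv_prodvl H1 H2.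
have H2M : (H2 <= M)%VS := subv_prodvr H1 H2.
have HN H : (H <= M)%VS -> (H * (M * <[v]>) <= M * <[v]>)%VS.
  by move=> HM; rewrite prodvA prodvSl // (subv_trans (prodvSl _ HM)) ?prodv_id.
pose N := (M * <[v]>)%VS; pose P := (V1 :&: N)%VS; pose Q := (V2 :&: N)%VS.
have HP : (H1 * P <= P)%VS by apply: module_cap => //; apply: HN.
have HQ : (H2 * Q <= Q)%VS by apply: module_cap => //; apply: HN.
have vN : v \in N by rewrite -[v]mul1r memv_mul ?mem1v ?memv_line.
have vP : v \in P by rewrite memv_cap vV1.
have dN : \dim N = \dim M by rewrite dim_cosetv.
have dV2 U : (U <= V1)%VS -> (U <= N)%VS ->
    (\dim V2 + \dim (U + Q) <= \dim (V1 + V2) + \dim Q)%N.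
  move=> UV UN; apply: dimv_leq_sum_cap; first exact: addvSr.
    by rewrite addvS // capvSl.
  by rewrite subv_cap capvSl (subv_trans (capvSr _ _)) // subv_add UN capvSr.
have dV1 U : (U <= V2)%VS -> (U <= N)%VS ->
    (\dim V1 + \dim (P + U) <= \dim (V1 + V2) + \dim P)%N.
  move=> UV UN; apply: dimv_leq_sum_cap; first exact: addvSl.
    by rewrite addvS // capvSl.
  by rewrite subv_cap capvSl (subv_trans (capvSr _ _)) // subv_add UN capvSr.
have [Q0 | Q0] := eqVneq Q 0%VS.
  have := dV2 _ (module_line HV1 vV1) (subv_trans (module_line HP vP) (capvSr _ _)).
  by rewrite Q0 addv0 dimv0 addn0 dim_cosetv // => ?; apply: Or31.
have ltQ : (\dim Q < \dim M)%N.
  rewrite -dN ltn_neqAle dimvS ?capvSr // andbT; apply: contraNneq vV2 => eQ.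
  have /eqP NQ : Q == N by rewrite eqEdim capvSr eQ /=.
  by move: vN; rewrite -NQ memv_cap => /andP[].
have dPQ2 := dV2 P (capvSl _ _) (capvSr _ _).
have dPQ1 := dV1 Q (capvSl _ _) (capvSr _ _).
have [ltP | geP] := ltnP (\dim P) (\dim M).
  have P0 : P != 0%VS by apply: contraTneq vP => ->; rewrite memv0.
  have [] := @dim_add_submodules H1 H2 P Q v v0 HP HQ (capvSr _ _) (capvSr _ _) P0 Q0 ltP ltQ.
    by move=> le; apply: Or32; apply: (leq_add_chain dPQ2).
  by move=> le; apply: Or33; apply: (leq_add_chain dPQ1).
apply: Or32; apply: (leq_add_chain dPQ2).
have /dvdnP[ga dQ] := field_module_dimS HQ.
have /dvdnP[m2 dM2] := field_dimS H2M.
apply: leq_trans (leq_addr _ _); apply: leq_trans (dimvS (addvSl P Q)).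
apply: leq_trans geP.
by move: ltQ; rewrite dQ dM2 ltn_mul2r => /andP[_ ?]; rewrite addnC -mulSn leq_mul.
Qed.

(** The linear analogue of Kneser's lemma on unions of periodic sets. If neither space contains the
    other, the sum is stable under [H1 :&: H2], and its growth makes up for the smaller
    stabilizer. *)
Lemma dim_add_modules (H1 H2 : {subfield L}) V1 V2 :
  (H1 * V1 <= V1)%VS -> (H2 * V2 <= V2)%VS ->
  exists H : {subfield L}, (H * (V1 + V2) <= V1 + V2)%VS /\
   ((\dim V1 + \dim H1 <= \dim (V1 + V2) + \dim H)%N \/
    (\dim V2 + \dim H2 <= \dim (V1 + V2) + \dim H)%N).
Proof.
move=> HV1 HV2.
have [/addv_idPr-> | /subvPn[v vV1 vV2]] := boolP (V1 <= V2)%VS.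
  by exists H2; split=> //; right.
have [/addv_idPl-> | /subvPn[w wV2 wV1]] := boolP (V2 <= V1)%VS.
  by exists H1; split=> //; left.
exists [aspace of (H1 :&: H2)%VS]; split=> /=.
  rewrite prodvDr addvS //; first exact: subv_trans (prodvSl _ (capvSl _ _)) HV1.
  exact: subv_trans (prodvSl _ (capvSr _ _)) HV2.
have [] := dim_add_modules_at HV1 HV2 vV1 vV2; [|by right|by left].
have := dim_add_modules_at HV2 HV1 wV2 wV1; rewrite addvC capvC => -[]; [|by left|by right].
(* Each bound involves the other space's subfield; the smaller of dim H1 and dim H2 may replace the
   larger. *)
move=> g1 g2; have := leq_total (\dim H1) (\dim H2) => /orP[le|le]; [left|right].
  by apply: leq_trans (leq_addr _ _); apply: leq_trans g1; rewrite leq_add2l.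
by apply: leq_trans (leq_addr _ _); apply: leq_trans g2; rewrite leq_add2l.
Qed.

(* Dyson's transform: replace (A, B) by (A :&: B/b, B + A b) for some b in B. *)
Lemma dyson_module A B : 1 \in A -> B != 0%VS ->
  exists H V, [/\ (B <= V)%VS, (V <= A * B)%VS, (H * V <= V)%VS
    & (\dim A + \dim B <= \dim V + \dim H)%N].
Proof.
elim: {A}_.+1 {-2}A (ltnSn (\dim A)) B => // n IHn A; rewrite ltnS => leAn B A1 B0.
(* If A B lies in B, then B is stable under the subfield generated by A. Otherwise some a b is
   outside B, and the transform with b makes A strictly smaller while preserving dim A + dim B. *)
have [AB | nAB] := boolP (A * B <= B)%VS.
  exists (agenv A)%AS, B; split=> //.
  - by rewrite -{1}[B]prod1v prodvSl // -memvE.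
  - exact: agenv_modl.
  - by rewrite addnC leq_add2l dimvS // sub_agenv.
have /existsNP[a /existsNP[b /not_implyP[aA /not_implyP[bB /negP abB]]]] :
    ~ {in A & B, forall u v, u * v \in B}.
  by move/prodvP; apply/negP.
have b0 : b != 0 by apply: contraNneq abB => ->; rewrite mulr0 mem0v.
pose A' := (A :&: B * <[b^-1]>)%VS; pose B' := (B + A * <[b]>)%VS.
have A'b : (A' * <[b]> = A * <[b]> :&: B)%VS.
  apply/vspaceP => x; rewrite memv_cap !mem_coset_line // memv_cap.
  by rewrite mem_coset_line ?invr_eq0 // invrK divfK.
have dA' : (\dim A' + \dim B' = \dim A + \dim B)%N.
  have := dimv_sum_cap (A * <[b]>) B; rewrite -A'b !dim_cosetv // addnC.
  by rewrite [(_ + B)%VS]addvC.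
have A'1 : 1 \in A'.
  by rewrite memv_cap A1 -(divff b0) memv_mul // memv_line.
have dA'A : (\dim A' < \dim A)%N.
  rewrite ltn_neqAle dimvS ?capvSl // andbT; apply: contraNneq abB => eA.
  have /eqP A'A : A' == A by rewrite eqEdim capvSl eA /=.
  move: aA; rewrite -A'A memv_cap => /andP[_].
  by rewrite mem_coset_line ?invr_eq0 // invrK.
have B'0 : B' != 0%VS.
  by rewrite -subv0; apply: contraNN B0 => /(subv_trans (addvSl _ _)); rewrite subv0.
have [H [V [BV VAB HV dV]]] := IHn A' (leq_trans dA'A leAn) B' A'1 B'0.
exists H, V; split=> //; first exact: subv_trans (addvSl _ _) BV.
  rewrite (subv_trans VAB) // prodvDr subv_add prodvSl ?capvSl //=.
  by rewrite prodvCA A'b prodvSr // capvSr.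
by rewrite -dA'.
Qed.

(* For inseparable L/F this is due to Bachoc, Serra and Zemor.                 *)
Theorem kneser A B : A != 0%VS -> B != 0%VS ->
  exists H, (H * (A * B) <= A * B)%VS /\
    (\dim A + \dim B <= \dim (A * B) + \dim H)%N.
Proof.
move=> A0 B0.
(* Dividing A by a puts 1 in it, as [dyson_module] requires; multiplying back by a keeps V inside A
   B. *)
have at_elt a : a \in A -> a != 0 -> exists H V,
    [/\ (<[a]> * B <= V)%VS, (V <= A * B)%VS, (H * V <= V)%VS
    & (\dim A + \dim B <= \dim V + \dim H)%N].
  move=> aA a0; pose A' := (A * <[a^-1]>)%VS.
  have A'1 : 1 \in A' by rewrite -(divff a0) memv_mul // memv_line.
  have [H [V [BV VAB HV dV]]] := dyson_module A'1 B0.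
  have a'0 : a^-1 != 0 by rewrite invr_eq0.
  exists H, (<[a]> * V)%VS; split.
  - exact: prodvSr.
  - rewrite (subv_trans (prodvSr _ VAB)) // prodvA prodvCA prodv_line.
    by rewrite divff // prodv1.
  - by rewrite prodvCA prodvSr.
  - by rewrite [(<[a]> * V)%VS]prodvC dim_cosetv // -(dim_cosetv A a'0).
have s0 : all (fun a => (a \in A) && (a != 0)) (vbasis A).
  apply/allP => a aA; rewrite vbasis_mem //=.
  exact: free_not0 (basis_free (vbasisP A)) aA.
have eA := span_basis (vbasisP A).
have sn : (vbasis A : seq L) <> [::].
  by move=> e; rewrite e span_nil in eA; rewrite -eA eqxx in A0.
suff [H [V [AV VAB HV dV]]] : exists H V,
    [/\ (<<vbasis A>> * B <= V)%VS, (V <= A * B)%VS, (H * V <= V)%VS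
    & (\dim A + \dim B <= \dim V + \dim H)%N].
  rewrite eA in AV; have /eqP eV : V == (A * B)%VS by rewrite eqEsubv VAB.
  by exists H; rewrite -eV.
(* The spaces V of the basis elements of A are added one by one; [dim_add_modules] preserves the
   bound each time. *)
elim: (vbasis A : seq L) s0 sn {eA} => // a s IHs /= /andP[/andP[aA a0] sA] _.
have [H1 [V1 [aV1 V1AB HV1 dV1]]] := at_elt a aA a0.
have [-> | /eqP sn] := eqVneq s [::].
  by exists H1, V1; split=> //; rewrite span_seq1.
have [H2 [V2 [sV2 V2AB HV2 dV2]]] := IHs sA sn.
have [H [HV dV]] := dim_add_modules HV1 HV2.
exists H, (V1 + V2)%VS; split=> //; first by rewrite span_cons prodvDl addvS.
  by rewrite subv_add V1AB.
by case: dV; apply: leq_trans.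
Qed.

(* Kneser's theorem for H * A and H * B, with H a larger and larger stabilizer *)
(* of the product.                                                             *)
Theorem kneser_stabilizer A B : A != 0%VS -> B != 0%VS ->
  exists H, (H * (A * B) <= A * B)%VS /\
    (\dim (H * A) + \dim (H * B) <= \dim (A * B) + \dim H)%N.
Proof.
move=> A0 B0.
suff main n : (exists H, [/\ (H * (A * B) <= A * B)%VS &
    (n <= \dim H)%N]) -> exists H, (H * (A * B) <= A * B)%VS /\
    (\dim (H * A) + \dim (H * B) <= \dim (A * B) + \dim H)%N.
  by apply: (main 0%N); exists 1%AS; rewrite prod1v.
have [k] := ubnP (\dim {:L} - n)%N; elim: k n => // k IHk n; rewrite ltnS => len.
move=> [H [HAB nH]].
have eAB : (H * A * (H * B) = A * B)%VS.
  apply/eqP; rewrite -prodvA [(A * _)%VS]prodvCA prodvA prodv_id eqEsubv HAB /=.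
  by rewrite -{1}[(A * B)%VS]prod1v prodvSl // sub1v.
have nz U : U != 0%VS -> (H * U)%VS != 0%VS.
  rewrite -!dimv_eq0 -!lt0n => U0.
  by apply: leq_trans U0 _; rewrite dimv_leq_prodv // -dimv_eq0 -lt0n adim_gt0.
have [H' [H'AB dH']] := kneser (nz _ A0) (nz _ B0); rewrite eAB in H'AB dH'.
have [le|lt] := leqP (\dim H') (\dim H).
  by exists H; split=> //; rewrite (leq_trans dH') // leq_add2l.
apply: (IHk n.+1); last by exists H'; split=> //; apply: leq_ltn_trans lt.
by apply: leq_subS len (leq_ltn_trans nH (leq_trans lt (dimvS (subvf H')))).
Qed.
End KneserTheorem.

(** * Flags and tower types *)

Section MixedRadix.
Local Open Scope nat_scope.

(** Digits from place s on contribute multiples of the partial product h; the lower ones add up to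
    less than h. *)
Lemma mixed_radix_modn T m d s : mixed_radix T m d -> s <= size T ->
  let h := \prod_(0 <= r < s) nth 0 T r in
  m %% h = \sum_(0 <= r < s) nth 0 d r * \prod_(0 <= r' < r) nth 0 T r' /\
  (m %% h < h).
Proof.
move=> [_ dT ->] sT h.
pose w r := \prod_(0 <= r' < r) nth 0 T r'.
have wS r : w r.+1 = w r * nth 0 T r by rewrite /w big_nat_recr.
have lt_sum r : r <= size T -> \sum_(0 <= r' < r) nth 0 d r' * w r' < w r.
  elim: r => [|r IHr] ler; first by rewrite /w !big_geq.
  rewrite big_nat_recr //= wS.
  have := IHr (ltnW ler); have := dT r ler.
  by move: (\sum_(_ <= _ < _) _) => z; nia.
have lt_s := lt_sum s sT.
suff -> : (\sum_(0 <= r < size T) nth 0 d r * w r) %% h =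
    \sum_(0 <= r < s) nth 0 d r * w r by [].
rewrite (@big_cat_nat _ _ _ s) //= -modnDmr.
suff /eqP-> : h %| \sum_(s <= r < size T) nth 0 d r * w r.
  by rewrite addn0 modn_small.
rewrite big_seq_cond; apply: dvdn_sum => r; rewrite andbT mem_index_iota => /andP[sr _].
by rewrite dvdn_mull // /w (@big_cat_nat _ _ _ s) //= dvdn_mulr.
Qed.

Lemma no_overflow_modn T i j s : no_overflow T i j -> s <= size T ->
  let h := \prod_(0 <= r < s) nth 0 T r in i %% h + j %% h < h.
Proof.
move=> [di [dj [dk [radi radj radk dijk]]]] sT /=.
set h := \prod_(_ <= _ < _) _.
have [ei _] := mixed_radix_modn radi sT; have [ej _] := mixed_radix_modn radj sT.
have [ek lek] := mixed_radix_modn radk sT; rewrite /h ei ej.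
suff <- : (i + j) %% h = \sum_(0 <= r < s) nth 0 di r * \prod_(0 <= r' < r) nth 0 T r' +
  \sum_(0 <= r < s) nth 0 dj r * \prod_(0 <= r' < r) nth 0 T r' by [].
rewrite ek -big_split /=.
rewrite big_nat [RHS]big_nat; apply: eq_bigr => r /andP[_ rs].
by rewrite -mulnDl dijk // (leq_trans rs).
Qed.
End MixedRadix.

Section Arithmetic.
Local Open Scope nat_scope.

(** Here x, y, z are the dimensions of H F_i, H F_j, F_i F_j. Kneser's bound forces c to be at least
    [(i %/ h + j %/ h).+1], and c h <= i + j forces the converse, so no slack remains. *)
Lemma tight_arith i j h x y z c : 0 < h -> z = c * h -> x + y <= z + h ->
  h * (i %/ h).+1 <= x -> h * (j %/ h).+1 <= y -> c * h <= i + j ->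
  [/\ h <= i %% h + j %% h, x = h * (i %/ h).+1, y = h * (j %/ h).+1
    & c = (i %/ h + j %/ h).+1].
Proof.
move=> h0 -> dH ilo jlo hi.
move: hi (divn_eq i h) (divn_eq j h) (ltn_pmod i h0) (ltn_pmod j h0).
move: (_ %/ _) (_ %/ _) (_ %% _) (_ %% _) ilo jlo => b a s r ilo jlo hi ei ej lr ls.
have hab : h * (a + b).+1 <= c * h.
  by rewrite -(leq_add2r h) (leq_trans _ dH) //; apply: leq_trans (leq_add ilo jlo); lia.
have ec : c = (a + b).+1.
  apply/eqP; rewrite eqn_leq; apply/andP; split; last first.
    by move: hab; rewrite mulnC leq_pmul2r.
  rewrite -ltnS -(ltn_pmul2r h0); apply: leq_ltn_trans hi _; rewrite ei ej.
  by rewrite !mulSn mulnDl; lia.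
rewrite ec in dH hi; split=> //.
- by move: hi; rewrite ei ej mulSn mulnDl; lia.
- apply/eqP; rewrite eqn_leq ilo andbT; lia.
- apply/eqP; rewrite eqn_leq jlo andbT; lia.
Qed.

(** The numerical core of the exclusion of coprime stabilizers: a, b, c, d stand for i / p, j / p, k
    / q, l / q rounded down, and the last five hypotheses bound intersections of flag spaces. *)
Lemma tight_coprime_arith p q i j k l a b c d :
  p * (a + b).+1 <= i + j -> i < p * a.+1 -> (a + b).+1 < q ->
  d <= c -> (c + d).+1 < p ->
  j.+1 <= b.+1 * d.+1 -> l <= k ->
  (i <= k -> i.+1 <= a.+1 * c.+1) ->
  (k <= i -> k.+1 <= a.+1 * c.+1) ->
  (l <= i -> l.+1 <= a.+1 * d.+1) ->
  (k + l <= i.+1 -> q * (c + d).+1 <= a.+1 * (c + d).+1) ->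
  (i.+1 <= k + l -> i.+1 + q * (c + d).+1 <= k + l + a.+1 * (c + d).+1) -> False.
Proof.
move=> ij ia abq dc sp jbd lk ik ki li kli ikl.
(* The carry gives j > p b, while j + 1 <= (b + 1) (d + 1) and 2 (d + 1) <= p. *)
have b0 : b = 0.
  have h1 : b.+1 * (2 * d.+1) <= b.+1 * p by rewrite leq_mul2l; lia.
  have h2 : p * (a + b).+1 = p * a.+1 + p * b by lia.
  case: b h1 h2 ij abq jbd => // b' h1 h2 ij abq jbd.
  have h3 : p * b'.+1 = p * b' + p by lia.
  have h4 : b'.+2 * p = p * b' + 2 * p by lia.
  lia.
rewrite b0 !addn0 mul1n in ij jbd abq.
have [le_ik | lt_ki] := leqP i k.
  have := ik le_ik.
  have h1 : a.+1 * c.+1 <= a.+1 * (p - d.+1) by rewrite leq_mul2l; lia.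
  have h2 : a.+1 * d.+1 <= a.+1 * p by rewrite leq_mul2l; lia.
  rewrite mulnBr in h1; lia.
(* Now l <= k < i; on either side of k + l = i + 1 the intersection of F_k F_l with F_i would be too
   large. *)
have k1 := ki (ltnW lt_ki); have l1 := li (leq_trans lk (ltnW lt_ki)).
have kl2 : k + l + 2 <= a.+1 * (c + d).+2.
  by apply: (@leq_trans (a.+1 * c.+1 + a.+1 * d.+1)); lia.
have [le | gt] := leqP (k + l) i.+1.
  by have := kli le; rewrite leq_pmul2r //; lia.
have := ikl (ltnW gt).
have h1 : a.+2 * (c + d).+1 <= q * (c + d).+1 by rewrite leq_mul2r; lia.
have h2 : a.+1 * (c + d).+2 <= a.+1 * p by rewrite leq_mul2l /=; lia.
rewrite mulSn in h1; rewrite [p * _]mulnC in ij ia.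
lia.
Qed.
End Arithmetic.

(** * Pairs that break subadditivity *)

Section Flag.
Context {F : fieldType} {L : fieldExtType F} (n : nat) (Fl : nat -> {vspace L}).
Hypothesis dimL : \dim {:L} = n.
Hypothesis dimFl : forall i, (i < n)%N -> \dim (Fl i) = i.+1.
Hypothesis FlS : forall i j, (i <= j)%N -> (Fl i <= Fl j)%VS.
Implicit Types (H : {subfield L}) (X Y : {vspace L}).

(** The equality case of Kneser's theorem: [h * (i %/ h).+1] is the least multiple of h that is at
    least i + 1 = dim F_i. *)
Definition tight i j H : Prop := let h := \dim H in
  [/\ (i + j < n)%N /\ (h <= i %% h + j %% h)%N,
      (Fl i * Fl j <= Fl (i + j).-1)%VS /\ (H * (Fl i * Fl j) <= Fl i * Fl j)%VS,
      \dim (H * Fl i) = (h * (i %/ h).+1)%N,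
      \dim (H * Fl j) = (h * (j %/ h).+1)%N
    & \dim (Fl i * Fl j) = (h * (i %/ h + j %/ h).+1)%N].

Lemma tightC i j H : tight i j H -> tight j i H.
Proof.
case=> -[ltn car] [FF HFF] di dj dij.
have eFF := prodvC (Fl i) (Fl j).
split=> //; first by rewrite addnC ltn addnC.
  by rewrite -eFF addnC.
by rewrite -eFF dij addnC.
Qed.

Lemma dim_module_Fl H i : (i < n)%N -> (\dim H * (i %/ \dim H).+1 <= \dim (H * Fl i))%N.
Proof.
move=> lti; have HHF : (H * (H * Fl i) <= H * Fl i)%VS by rewrite prodvA prodv_id.
have /dvdnP[c dc] := field_module_dimS HHF.
rewrite dc mulnC leq_pmul2r ?adim_gt0 // ltn_divLR ?adim_gt0 // -dc.
by rewrite -(dimFl lti) dimv_leq_prodv // -dimv_eq0 -lt0n adim_gt0.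
Qed.

Lemma tightP i j : (0 < i)%N -> (0 < j)%N -> (i + j < n)%N ->
  (Fl i * Fl j <= Fl (i + j).-1)%VS -> exists H, tight i j H.
Proof.
move=> i0 j0 ltij FF.
have lti : (i < n)%N by apply: leq_ltn_trans ltij; apply: leq_addr.
have ltj : (j < n)%N by apply: leq_ltn_trans ltij; apply: leq_addl.
have nz m : (m < n)%N -> Fl m != 0%VS by move=> ltm; rewrite -dimv_eq0 dimFl.
have [H [HFF dH]] := kneser_stabilizer (nz _ lti) (nz _ ltj).
have /dvdnP[c dc] := field_module_dimS HFF.
have ilo := dim_module_Fl H lti; have jlo := dim_module_Fl H ltj.
have := dimvS FF; rewrite dimFl ?dc ?(leq_ltn_trans (leq_pred _)) //.
rewrite prednK ?addn_gt0 ?i0 // => hi.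
exists H; have h0 := adim_gt0 H.
have [car e1 e2 e3] := tight_arith h0 dc dH ilo jlo hi.
by split=> //; rewrite dc e3 mulnC.
Qed.

(** The triangle inequality for [X :&: Y], whose products with H and H' lie in H X and H' Y. *)
Lemma dim_cap_modules (H H' : {subfield L}) X Y :
  (\dim (X :&: Y) * \dim (H * H') <= \dim (H * X) * \dim (H' * Y))%N.
Proof.
have [-> | nz] := eqVneq (X :&: Y)%VS 0%VS; first by rewrite dimv0 mul0n.
apply: leq_trans (dim_prodv_triangle H H' nz) _.
by rewrite leq_mul // dimvS // prodvC prodvSr ?capvSl ?capvSr.
Qed.

Lemma dvdn_dim_subfield H : (\dim H %| n)%N.
Proof. by rewrite -dimL field_dimS ?subvf. Qed.

Lemma dim_prodv_coprime (H H' : {subfield L}) p q : \dim H = p -> \dim H' = q ->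
  coprime p q -> n = (p * q)%N -> \dim (H * H') = n.
Proof.
move=> dH dH' cop en; apply/eqP; rewrite eqn_dvd.
rewrite (dvdn_dim_subfield (H * H')%AS) {1}en Gauss_dvd // -dH -dH' /=.
by rewrite !field_dimS // ?subv_prodvl ?subv_prodvr.
Qed.

(** As H H' = L, [dim_cap_modules] bounds dim (X :&: Y) by (dim (H X) / p) (dim (H' Y) / q). Nested
    flag spaces intersect in the smaller one, which turns this into the hypotheses of
    [tight_coprime_arith]. *)
Lemma tight_coprime_ordered p q i j k l (H H' : {subfield L}) :
  coprime p q -> n = (p * q)%N -> \dim H = p -> \dim H' = q ->
  tight i j H -> tight k l H' -> (l <= k)%N -> (j <= l)%N -> False.
Proof.
move=> cop en dH dH' [[ltij cij] [FFij HFF] dHi dHj dHij]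
  [[ltkl ckl] [FFkl HFFkl] dHk dHl dHkl] lk jl.
have dHH' := dim_prodv_coprime dH dH' cop en.
rewrite dH in dHi dHj dHij cij; rewrite dH' in dHk dHl dHkl ckl.
have p0 : (0 < p)%N by rewrite -dH adim_gt0.
have q0 : (0 < q)%N by rewrite -dH' adim_gt0.
have cap X Y x y : \dim (H * X) = (p * x)%N -> \dim (H' * Y) = (q * y)%N ->
    (\dim (X :&: Y) <= x * y)%N.
  move=> dX dY; have := dim_cap_modules H H' X Y.
  by rewrite dHH' dX dY mulnACA -en mulnC leq_pmul2l // en muln_gt0 p0.
have dF m : (m < n)%N -> \dim (Fl m) = m.+1 by exact: dimFl.
have capF m m' x y : (m <= m')%N -> (m' < n)%N -> \dim (H * Fl m) = (p * x)%N ->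
    \dim (H' * Fl m') = (q * y)%N -> (m.+1 <= x * y)%N.
  move=> le lt dm dm'; rewrite -dF ?(leq_ltn_trans le) //.
  by rewrite -(capv_idPl (FlS le)) cap.
have capF' m m' x y : (m' <= m)%N -> (m < n)%N -> \dim (H * Fl m) = (p * x)%N ->
    \dim (H' * Fl m') = (q * y)%N -> (m'.+1 <= x * y)%N.
  move=> le lt dm dm'; rewrite -dF ?(leq_ltn_trans le) //.
  by rewrite -(capv_idPr (FlS le)) cap.
have lti : (i < n)%N by apply: leq_ltn_trans ltij; apply: leq_addr.
have ltk : (k < n)%N by apply: leq_ltn_trans ltkl; apply: leq_addr.
have ltl : (l < n)%N by apply: leq_ltn_trans ltkl; apply: leq_addl.
have ltij' := leq_ltn_trans (leq_pred _) ltij.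
have ltkl' := leq_ltn_trans (leq_pred _) ltkl.
have kl0 : (0 < k + l)%N.
  rewrite lt0n; apply: contraTneq ckl => /eqP; rewrite addn_eq0.
  by case/andP=> /eqP-> /eqP->; rewrite mod0n -ltnNge.
have ij0 : (0 < i + j)%N.
  rewrite lt0n; apply: contraTneq cij => /eqP; rewrite addn_eq0.
  by case/andP=> /eqP-> /eqP->; rewrite mod0n -ltnNge.
have hij := dimvS FFij; rewrite dHij dF // prednK // in hij.
have hkl := dimvS FFkl; rewrite dHkl dF // prednK // in hkl.
have dHkl' : \dim (H' * (Fl k * Fl l)) = (q * (k %/ q + l %/ q).+1)%N.
  rewrite -dHkl; apply/eqP; rewrite eqn_leq (dimvS HFFkl) /=.
  by rewrite dimv_leq_prodv // -dimv_eq0 -lt0n adim_gt0.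
apply: (@tight_coprime_arith p q i j k l (i %/ p) (j %/ p) (k %/ q) (l %/ q)) => //.
- by rewrite mulnC ltn_ceil.
- by rewrite -(ltn_pmul2l p0) -en (leq_ltn_trans hij).
- exact: leq_div2r.
- by rewrite -(ltn_pmul2l q0) [ltnRHS]mulnC -en (leq_ltn_trans hkl).
- exact: (capF j l).
- by move=> ik; apply: (capF i k).
- by move=> ki; apply: (capF' i k).
- by move=> li; apply: (capF' i l).
- move=> kli; rewrite -dHkl; have /capv_idPr <- : (Fl k * Fl l <= Fl i)%VS.
    by rewrite (subv_trans FFkl) // FlS // -ltnS prednK.
  exact: cap.
(* Both F_i and F_k F_l lie in F_(k+l-1), which bounds their intersection from below. *)
- move=> ikl; rewrite -dHkl -(dF i lti).
  apply: leq_trans (leq_add (leqnn _) (cap _ _ _ _ dHi dHkl')).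
  rewrite -[X in (_ <= X + _)%N](prednK kl0) -(dF (k + l).-1) //.
  by apply: dimv_leq_sum_cap => //; apply: FlS; rewrite -ltnS prednK.
Qed.

Lemma tight_coprime p q i j k l (H H' : {subfield L}) :
  coprime p q -> n = (p * q)%N -> \dim H = p -> \dim H' = q ->
  tight i j H -> tight k l H' -> False.
Proof.
move=> cop en dH dH'.
wlog ji : i j / (j <= i)%N => [wl t | ].
  by have [ji | /ltnW ij] := leqP j i; [exact: wl t | exact: wl (tightC t)].
wlog lk : k l / (l <= k)%N => [wl t t' | t t'].
  by have [lk | /ltnW kl] := leqP l k; [exact: wl t t' | exact: wl t (tightC t')].
have [jl | /ltnW lj] := leqP j l.
  exact: (tight_coprime_ordered cop en dH dH' t t').
apply: (tight_coprime_ordered _ _ dH' dH t' t) => //; first by rewrite coprime_sym.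
by rewrite mulnC.
Qed.
End Flag.

(** * Carries, and the finite check in degree 12 *)

Section Carries.
Local Open Scope nat_scope.

Definition carry (h i j : nat) : bool := h <= i %% h + j %% h.

Definition tower_carry (T : seq nat) (i j : nat) : Prop :=
  exists2 s, s <= size T & carry (\prod_(0 <= r < s) nth 0 T r) i j.

Lemma dvdn_mul_primes p q h : prime p -> prime q -> h %| p * q ->
  [\/ h = 1, h = p, h = q | h = p * q].
Proof.
move=> pp pq hpq; have [ph | ] := boolP (p %| h).
  have [m em] := dvdnP ph; move: hpq; rewrite em mulnC dvdn_pmul2l ?prime_gt0 //.
  case/primeP: pq => _ /[apply] /orP[] /eqP->; last exact: Or44.
  by rewrite muln1; apply: Or42.
rewrite -prime_coprime // coprime_sym => cop; move: hpq; rewrite Gauss_dvdr //.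
by case/primeP: pq => _ /[apply] /orP[] /eqP->; [apply: Or41 | apply: Or43].
Qed.

Lemma dvdn12 h : h %| 12 -> h \in [:: 1; 2; 3; 4; 6; 12].
Proof. by rewrite dvdn_divisors. Qed.

(* A triple (i, j, h) stands for a tight pair (i, j) with stabilizer H of      *)
(* degree h.  An entry (d, s, m) of flag_spaces stands for one of the spaces   *)
(* X = F_i, F_j, F_i F_j: dim X = d, dim HX = s, and X lies in F_m.            *)
Definition flag_spaces (P : nat * nat * nat) : seq (nat * nat * nat) :=
  let: (i, j, h) := P in
  [:: (i.+1, h * (i %/ h).+1, i); (j.+1, h * (j %/ h).+1, j);
      (h * (i %/ h + j %/ h).+1, h * (i %/ h + j %/ h).+1, (i + j).-1)].

(* e is the degree of HH'.  The second clause: if HX = X lies in Y, then HH'X  *)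
(* is a space over HH' between X and H'Y.                                      *)
Definition compatible_spaces (e : nat) (X Y : nat * nat * nat) : bool :=
  let: (d, s, m) := X in let: (d', s', m') := Y in
  ((d + d' - (maxn m m').+1) * e <= s * s') &&
  ([&& d == s, m <= m' & d' == m'.+1] ==> ((d + e.-1) %/ e * e <= s')).

Definition compatible12 (P Q : nat * nat * nat) : bool :=
  has (fun e => [&& P.2 %| e, Q.2 %| e, e <= P.2 * Q.2 &
     all (fun X => all (compatible_spaces e X) (flag_spaces Q)) (flag_spaces P)])
    [:: 1; 2; 3; 4; 6; 12].

Definition triples12 : seq (nat * nat * nat) :=
  [seq P <- [seq (ij, h) | ij <- [seq (i, j) | i <- iota 0 12, j <- iota 0 12],
                           h <- [:: 1; 2; 3; 4; 6; 12]] |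
     let: (i, j, h) := P in (i + j < 12) && carry h i j].

(** h and h' are the proper partial products of a tower of length three; the products 1 and 12 never
    carry when i + j < 12. *)
Definition avoids (h h' : nat) (P : nat * nat * nat) : bool :=
  ~~ carry h P.1.1 P.1.2 && ~~ carry h' P.1.1 P.1.2.

(** P, Q, R obstruct the towers (2,2,3), (2,3,2), (3,2,2) respectively; enumeration shows that no
    three such triples are pairwise compatible. *)
Lemma incompatible12 P Q R :
  P \in triples12 -> Q \in triples12 -> R \in triples12 ->
  avoids 2 4 P -> avoids 2 6 Q -> avoids 3 6 R ->
  ~~ [&& compatible12 P Q, compatible12 P R & compatible12 Q R].
Proof.
have check : all (fun P => all (fun Q => all (fun R =>
    ~~ [&& compatible12 P Q, compatible12 P R & compatible12 Q R])
   (filter (avoids 3 6) triples12)) (filter (avoids 2 6) triples12))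
   (filter (avoids 2 4) triples12) by vm_cast_no_check (erefl true).
move=> PS QS RS aP aQ aR.
have fil h h' S : S \in triples12 -> avoids h h' S -> S \in filter (avoids h h') triples12.
  by move=> SS aS; rewrite mem_filter aS.
exact: (allP (allP (allP check P (fil _ _ _ PS aP)) Q (fil _ _ _ QS aQ)) R (fil _ _ _ RS aR)).
Qed.
End Carries.

Section Flag.
Context {F : fieldType} {L : fieldExtType F} (n : nat) (Fl : nat -> {vspace L}).
Hypothesis dimL : \dim {:L} = n.
Hypothesis dimFl : forall i, (i < n)%N -> \dim (Fl i) = i.+1.
Hypothesis FlS : forall i j, (i <= j)%N -> (Fl i <= Fl j)%VS.
Implicit Types (H : {subfield L}) (X Y : {vspace L}).

Notation tight := (tight n Fl).

Lemma tight_carry i j H : tight i j H -> carry (\dim H) i j.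
Proof. by case=> -[]. Qed.

Lemma tight_dim_neq1 i j H : tight i j H -> \dim H != 1%N.
Proof. by case=> -[_ car] _ _ _ _; apply: contraTneq car => ->; rewrite !modn1. Qed.

Lemma tight_dim_neqn i j H : tight i j H -> \dim H != n.
Proof.
case=> -[ltn car] _ _ _ _; apply: contraTneq car => ->; rewrite -ltnNge.
by rewrite !modn_small // (leq_ltn_trans _ ltn) ?leq_addr ?leq_addl.
Qed.

(** Both spaces lie in the larger of F_m and F_m', which bounds [X :&: Y] from below, while
    [dim_cap_modules] bounds it from above. *)
Lemma compatible_spacesP (H H' : {subfield L}) (X Y : {vspace L}) m m' :
  (X <= Fl m)%VS -> (Y <= Fl m')%VS -> (m < n)%N -> (m' < n)%N ->
  compatible_spaces (\dim (H * H'))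
    (\dim X, \dim (H * X), m) (\dim Y, \dim (H' * Y), m').
Proof.
move=> XF YF ltm ltm'; apply/andP; split.
  apply: leq_trans (dim_cap_modules H H' X Y); rewrite leq_mul2r; apply/orP; right.
  rewrite leq_subLR -(dimFl (i := maxn m m')) ?gtn_max ?ltm //.
  apply: dimv_leq_sum_cap => //.
    by rewrite (subv_trans XF) // FlS ?leq_maxl.
  by rewrite (subv_trans YF) // FlS ?leq_maxr.
apply/implyP => /and3P[/eqP eX le /eqP eY].
have HX : (H * X = X)%VS.
  apply/eqP; rewrite eq_sym eqEdim eX leqnn andbT.
  by rewrite -{1}[X]prod1v prodvSl // sub1v.
have {}eY : Y = Fl m' by apply/eqP; rewrite eqEdim YF dimFl // eY /=.
have XY : (X <= Y)%VS by rewrite eY (subv_trans XF) // FlS.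
have HHX : ((H * H')%AS * ((H * H')%AS * X) <= (H * H')%AS * X)%VS.
  by rewrite prodvA prodv_id.
have /dvdnP[c dc] := field_module_dimS HHX.
have dX : (\dim X <= \dim ((H * H')%AS * X))%N.
  by rewrite dimv_leq_prodv // -dimv_eq0 -lt0n adim_gt0.
apply: (@leq_trans (\dim ((H * H')%AS * X))); last first.
  by rewrite /= [(H * H')%VS]prodvC -prodvA HX dimvS // prodvSr.
move: dX; rewrite dc => dX; rewrite leq_mul2r; apply/orP; right.
have e0 := adim_gt0 (H * H')%AS.
rewrite -ltnS ltn_divLR // mulSn [ltnRHS]addnC.
by rewrite -addnS (prednK e0) leq_add2r.
Qed.

Lemma compatible12P i j k l (H H' : {subfield L}) : n = 12%N ->
  tight i j H -> tight k l H' -> compatible12 (i, j, \dim H) (k, l, \dim H').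
Proof.
move=> n12 t t'; apply/hasP; exists (\dim (H * H')).
  have := dvdn_dim_subfield dimL (H * H')%AS.
  by rewrite n12 => /dvdn12.
apply/and4P; split.
- by rewrite /= field_dimS // ?subv_prodvl.
- by rewrite /= field_dimS // ?subv_prodvr.
- exact: dim_prodv.
have spaces a b K : tight a b K -> forall P, P \in flag_spaces (a, b, \dim K) ->
    exists X m, [/\ (X <= Fl m)%VS, (m < n)%N & P = (\dim X, \dim (K * X), m)].
  case=> -[ltab car] [FF KFF] da db dab P.
  have lta : (a < n)%N by apply: leq_ltn_trans ltab; apply: leq_addr.
  have ltb : (b < n)%N by apply: leq_ltn_trans ltab; apply: leq_addl.
  rewrite !inE => /or3P[] /eqP->.
  - by exists (Fl a), a; rewrite dimFl // da.
  - by exists (Fl b), b; rewrite dimFl // db.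
  exists (Fl a * Fl b)%VS, (a + b).-1; split=> //.
    by apply: leq_ltn_trans ltab; apply: leq_pred.
  by rewrite (field_module_eq KFF) dab.
apply/allP => P /(spaces _ _ _ t)[X [m [XF ltm ->]]].
apply/allP => Q /(spaces _ _ _ t')[Y [m' [YF ltm' ->]]].
exact: compatible_spacesP.
Qed.

Lemma mem_triples12 i j H : n = 12%N -> tight i j H ->
  (i, j, \dim H) \in triples12.
Proof.
move=> n12 t; have [[ltn _] _ _ _ _] := t; rewrite n12 in ltn.
have lti : (i < 12)%N by apply: leq_ltn_trans ltn; apply: leq_addr.
have ltj : (j < 12)%N by apply: leq_ltn_trans ltn; apply: leq_addl.
rewrite mem_filter ltn (tight_carry t).
apply/allpairsPdep; exists (i, j), (\dim H); split=> //.
  by apply/allpairsPdep; exists i, j; rewrite !mem_iota.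
by have := dvdn_dim_subfield dimL H; rewrite n12 => /dvdn12.
Qed.

(** A tight pair carries at dim H, so a tower works as soon as its partial products include the
    degrees of all stabilizers. *)
Lemma flag_tower_type :
  [\/ exists p r : nat, [/\ prime p, (1 <= r)%N & n = (p ^ r)%N],
      exists p q : nat, [/\ prime p, prime q, p <> q & n = (p * q)%N]
    | n = 12%N] ->
  exists T, tower_type n T /\ forall i j, (0 < i)%N -> (0 < j)%N ->
    (i + j < n)%N -> (Fl i * Fl j <= Fl (i + j).-1)%VS -> tower_carry T i j.
Proof.
suff main : [\/ exists p r : nat, [/\ prime p, (1 <= r)%N & n = (p ^ r)%N],
      exists p q : nat, [/\ prime p, prime q, p <> q & n = (p * q)%N]
    | n = 12%N] -> exists T, tower_type n T /\ forall i j H, tight i j H -> tower_carry T i j.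
  move=> cn; have [T [towT carT]] := main cn; exists T; split=> // i j i0 j0 ltn FF.
  by have [H /carT] := tightP dimFl i0 j0 ltn FF.
case=> [[p [r [pp r0 en]]] | [p [q [pp pq pnq en]]] | n12].
- exists (nseq r p); split.
    split; first by rewrite all_nseq prime_gt1 ?orbT.
    by rewrite big_nseq iter_muln_1.
  move=> i j H t; have := dvdn_dim_subfield dimL H; rewrite en.
  case/(dvdn_pfactor _ _ pp) => s sr ds; exists s; rewrite ?size_nseq //.
  have -> : (\prod_(0 <= k < s) nth 0 (nseq r p) k)%N = \dim H.
    rewrite ds big_nat (eq_bigr (fun=> p)); last first.
      by move=> k /andP[_ ks]; rewrite nth_nseq (leq_trans ks).
    by rewrite -big_nat prod_nat_const_nat subn0.
  exact: tight_carry t.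
(* Degrees 1 and n do not occur, and p and q exclude each other, so (p, q) or (q, p) works. *)
- have cop : coprime p q by rewrite prime_coprime // dvdn_prime2 //; apply/eqP.
  have dimH i j H : tight i j H -> \dim H = p \/ \dim H = q.
    move=> t; have := dvdn_dim_subfield dimL H; rewrite en.
    case/(dvdn_mul_primes pp pq) => e; [|by left|by right|].
      by have := tight_dim_neq1 t; rewrite e.
    by have := tight_dim_neqn t; rewrite e en eqxx.
  have tow (p' q' : nat) : prime p' -> prime q' -> n = (p' * q')%N ->
      (forall i j H, tight i j H -> \dim H = p') ->
      exists T, tower_type n T /\ forall i j H, tight i j H -> tower_carry T i j.
    move=> pp' pq' en' dp; exists [:: p'; q']; split.
      by split; rewrite /= ?prime_gt1 // !big_cons big_nil muln1.
    move=> i j H t; exists 1%N => //.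
    by rewrite big_nat1 /= -(dp _ _ _ t) tight_carry.
  have [allp | ] := pselect (forall i j H, tight i j H -> \dim H = p).
    exact: (tow p q).
  move/existsNP=> [i /existsNP[j /existsNP[H /not_implyP[t neq]]]].
  have [// | dHq] := dimH _ _ _ t.
  apply: (tow q p) => //; first by rewrite mulnC.
  move=> k l H' t'; have [dHp | //] := dimH _ _ _ t'.
  by case: (tight_coprime dimL dimFl FlS cop en dHp dHq t' t).
have tow T : tower_type n T ->
    (exists T, tower_type n T /\ forall i j H, tight i j H -> tower_carry T i j)
    \/ exists i j H, tight i j H /\ forall s, (s <= size T)%N ->
         ~~ carry (\prod_(0 <= r < s) nth 0%N T r)%N i j.
  move=> towT; have [] := pselect (forall i j H, tight i j H -> tower_carry T i j).
    by left; exists T.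
  move/existsNP=> [i /existsNP[j /existsNP[H /not_implyP[t ncar]]]]; right.
  exists i, j, H; split=> // s sT; apply/negP => car; apply: ncar; exists s => //.
have tow12 T : all (fun m => 1 < m)%N T -> (\prod_(m <- T) m = 12)%N -> tower_type n T.
  by rewrite n12.
have [|//|[i1 [j1 [H1 [t1 c1]]]]] := tow [:: 2; 2; 3]%N.
  by apply: tow12; rewrite // !big_cons big_nil.
have [|//|[i2 [j2 [H2 [t2 c2]]]]] := tow [:: 2; 3; 2]%N.
  by apply: tow12; rewrite // !big_cons big_nil.
have [|//|[i3 [j3 [H3 [t3 c3]]]]] := tow [:: 3; 2; 2]%N.
  by apply: tow12; rewrite // !big_cons big_nil.
exfalso.
have prods (p q r : nat) : (\prod_(0 <= s < 1) nth 0 [:: p; q; r] s = p)%N /\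
    (\prod_(0 <= s < 2) nth 0 [:: p; q; r] s = p * q)%N.
  by rewrite !big_nat_recr //= !big_geq // mul1n.
have avoid p q r i j H : (forall s, (s <= 3)%N ->
    ~~ carry (\prod_(0 <= t < s) nth 0%N [:: p; q; r] t)%N i j) ->
    avoids p (p * q) (i, j, \dim H).
  move=> c; have := c 1%N isT; have := c 2%N isT.
  by rewrite !(prods p q r).1 (prods p q r).2 /avoids => -> ->.
have := incompatible12 (mem_triples12 n12 t1) (mem_triples12 n12 t2)
  (mem_triples12 n12 t3) (avoid _ _ _ _ _ _ c1) (avoid _ _ _ _ _ _ c2)
  (avoid _ _ _ _ _ _ c3).
by rewrite (compatible12P n12 t1 t2) (compatible12P n12 t1 t3) (compatible12P n12 t2 t3).
Qed.
End Flag.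

(** * Global sections of a geometrically integral cover *)

Import Pdiv.CommonRing Pdiv.RingMonic.

Section QpolyQuotient.
Context {R : comNzRingType} (h : {poly R}).

Lemma in_qpoly_eq0 (p : {poly R}) : in_qpoly h (p * mk_monic h) = 0.
Proof. by apply/val_inj; rewrite /= rmodp_mull ?monic_mk_monic. Qed.

Lemma in_qpoly_val (p : {poly %/ h}) : in_qpoly h p = p.
Proof. by apply/val_inj/in_qpoly_small/size_mk_monic. Qed.
End QpolyQuotient.

(* A[X]/(m) is the base change of A to the field k[X]/(m). *)
Section BaseChangeQuotient.
Context {k : fieldType} (A : comAlgType k) (m : {poly k}).
Hypothesis mI : monic_irreducible_poly m.

Definition residue_field : fieldType := {poly %/ m with mI}.

Definition lift_poly : {poly k} -> {poly A} := map_poly (GRing.in_alg A).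

HB.instance Definition _ := GRing.RMorphism.on lift_poly.

Lemma size_lift_poly p : size (lift_poly p) = size p.
Proof. by apply: size_map_inj_poly; [exact: fmorph_inj | rewrite rmorph0]. Qed.

Lemma lift_poly_monic p : p \is monic -> lift_poly p \is monic.
Proof. exact: monic_map. Qed.

(** [{poly %/ h}] is the quotient by [mk_monic h], which is h itself when h is monic and
    nonconstant. *)
Lemma mk_monic_lift : mk_monic (lift_poly m) = lift_poly m.
Proof.
rewrite /mk_monic size_lift_poly lift_poly_monic ?mI // andbT.
Qed.

Definition base_change_quotient (_ : monic_irreducible_poly m) : Type :=
  {poly %/ lift_poly m}.
Local Notation B := (base_change_quotient mI).

HB.instance Definition _ := GRing.ComNzRing.copy B {poly %/ lift_poly m}.

Definition poly_class (p : {poly A}) : B := in_qpoly (lift_poly m) p.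

Fact poly_class_is_zmod_morphism : zmod_morphism poly_class.
Proof. exact: (raddfB (in_qpoly (lift_poly m))). Qed.
Fact poly_class_is_monoid_morphism : monoid_morphism poly_class.
Proof. exact: in_qpoly_monoid_morphism. Qed.
HB.instance Definition _ :=
  GRing.isZmodMorphism.Build {poly A} B poly_class poly_class_is_zmod_morphism.
HB.instance Definition _ :=
  GRing.isMonoidMorphism.Build {poly A} B poly_class poly_class_is_monoid_morphism.

Definition class_poly (b : B) : {poly A} := val (b : {poly %/ lift_poly m}).

Lemma class_polyK : cancel class_poly poly_class.
Proof. exact: in_qpoly_val. Qed.

Lemma poly_class_modulus (p : {poly A}) : poly_class (p * lift_poly m) = 0.
Proof. by rewrite -[X in p * X]mk_monic_lift; apply: in_qpoly_eq0. Qed.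

Lemma poly_class_eq0 (p : {poly A}) : (size p < size m)%N -> poly_class p = 0 -> p = 0.
Proof.
move=> sp /(congr1 class_poly); rewrite /class_poly /poly_class /= rmodp_small //.
by rewrite mk_monic_lift size_lift_poly.
Qed.

Definition residue_class (p : {poly k}) : residue_field := in_qpoly m p.
Definition residue_poly (c : residue_field) : {poly k} := val (c : {poly %/ m}).

Fact residue_class_is_zmod_morphism : zmod_morphism residue_class.
Proof. exact: (raddfB (in_qpoly m)). Qed.
Fact residue_class_is_monoid_morphism : monoid_morphism residue_class.
Proof. exact: in_qpoly_monoid_morphism. Qed.
HB.instance Definition _ :=
  GRing.isZmodMorphism.Build {poly k} residue_field residue_class residue_class_is_zmod_morphism.
HB.instance Definition _ :=
  GRing.isMonoidMorphism.Build {poly k} residue_field residue_class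
    residue_class_is_monoid_morphism.

Lemma residue_polyK : cancel residue_poly residue_class.
Proof. exact: in_qpoly_val. Qed.

Lemma residue_class_modulus p : residue_class (p * m) = 0.
Proof. by rewrite -[X in p * X](mk_monicE mI); apply: in_qpoly_eq0. Qed.

Lemma residue_classP p q : residue_class p = residue_class q ->
  poly_class (lift_poly p) = poly_class (lift_poly q).
Proof.
move=> /eqP; rewrite -subr_eq0 -raddfB => /eqP/(congr1 residue_poly)/= e.
apply/eqP; rewrite -subr_eq0 -!raddfB; apply/eqP.
move: e; rewrite /residue_poly /= mk_monicE // => e.
rewrite [X in lift_poly X](rdivp_eq (snd mI)) e addr0 rmorphM.
exact: poly_class_modulus.
Qed.

Definition residue_scalar (c : residue_field) : B :=
  poly_class (lift_poly (residue_poly c)).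

Lemma residue_scalarE p : residue_scalar (residue_class p) = poly_class (lift_poly p).
Proof. by apply: residue_classP; rewrite residue_polyK. Qed.

Fact residue_scalar_is_zmod_morphism : zmod_morphism residue_scalar.
Proof.
by move=> x y; rewrite -[x]residue_polyK -[y]residue_polyK -raddfB !residue_scalarE !raddfB.
Qed.
Fact residue_scalar_is_monoid_morphism : monoid_morphism residue_scalar.
Proof.
split; first by rewrite -(rmorph1 residue_class) residue_scalarE !rmorph1.
by move=> x y; rewrite -[x]residue_polyK -[y]residue_polyK -rmorphM !residue_scalarE !rmorphM.
Qed.
HB.instance Definition _ :=
  GRing.isZmodMorphism.Build residue_field B residue_scalar residue_scalar_is_zmod_morphism.
HB.instance Definition _ :=
  GRing.isMonoidMorphism.Build residue_field B residue_scalar residue_scalar_is_monoid_morphism.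

Definition base_change_scale (c : residue_field) (b : B) : B := residue_scalar c * b.

Fact base_change_scaleA a b v :
  base_change_scale a (base_change_scale b v) = base_change_scale (a * b) v.
Proof. by rewrite /base_change_scale rmorphM mulrA. Qed.
Fact base_change_scale1 : left_id 1 base_change_scale.
Proof. by move=> v; rewrite /base_change_scale rmorph1 mul1r. Qed.
Fact base_change_scaleDr : right_distributive base_change_scale +%R.
Proof. by move=> a u v; rewrite /base_change_scale mulrDr. Qed.
Fact base_change_scaleDl v : {morph base_change_scale^~ v : a b / a + b}.
Proof. by move=> a b; rewrite /base_change_scale rmorphD mulrDl. Qed.
HB.instance Definition _ := GRing.Zmodule_isLmodule.Build residue_field B
  base_change_scaleA base_change_scale1 base_change_scaleDr base_change_scaleDl.

Fact base_change_scaleAl (a : residue_field) (u v : B) : a *: (u * v) = a *: u * v.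
Proof. exact: mulrA. Qed.
HB.instance Definition _ := GRing.Lmodule_isLalgebra.Build residue_field B base_change_scaleAl.
Fact base_change_scaleAr (a : residue_field) (u v : B) : a *: (u * v) = u * (a *: v).
Proof. exact: mulrCA. Qed.
HB.instance Definition _ := GRing.Lalgebra_isAlgebra.Build residue_field B base_change_scaleAr.

Lemma base_change_scaleE (c : residue_field) (b : B) : c *: b = residue_scalar c * b.
Proof. by []. Qed.

Definition residue_embed (c : k) : residue_field := residue_class c%:P.
HB.instance Definition _ := GRing.RMorphism.copy residue_embed (residue_class \o polyC).

Definition base_change_map (a : A) : B := poly_class a%:P.
HB.instance Definition _ := GRing.RMorphism.copy base_change_map (poly_class \o polyC).

Fact base_change_map_scalable : scalable_for (residue_embed \; *:%R) base_change_map.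
Proof.
move=> c a; rewrite /= base_change_scaleE residue_scalarE /base_change_map -rmorphM.
by rewrite /lift_poly map_polyC /= -polyCM mulr_algl.
Qed.
HB.instance Definition _ := GRing.isScalable.Build k A B (residue_embed \; *:%R)
  base_change_map base_change_map_scalable.


Section Universal.
Variables (D : comAlgType residue_field) (g : {lrmorphism A -> D | residue_embed \; *:%R}).

Definition base_change_var : residue_field := residue_class 'X.

Definition poly_eval (p : {poly A}) : D := (map_poly g p).[base_change_var%:A].
HB.instance Definition _ := GRing.RMorphism.copy poly_eval
  (horner_eval (base_change_var%:A : D) \o map_poly g).

Lemma poly_eval_lift p : poly_eval (lift_poly p) = (residue_class p)%:A.
Proof.
elim/poly_ind: p => [|p c IHp]; first by rewrite !raddf0 scale0r.
rewrite !rmorphD !rmorphM /= IHp /lift_poly map_polyX map_polyC /=.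
rewrite /poly_eval map_polyX map_polyC hornerX hornerC.
have gc : (g : A -> D) c%:A = (residue_class c%:P)%:A.
  by rewrite linearZ_LR /= rmorph1.
rewrite [X in _ + X]gc.
by rewrite scalerDl -scalerAl mul1r scalerA.
Qed.

Lemma poly_eval_class p : poly_eval (class_poly (poly_class p)) = poly_eval p.
Proof.
rewrite [p in RHS](rdivp_eq (monic_mk_monic (lift_poly m))) rmorphD rmorphM /=.
have -> : poly_eval (mk_monic (lift_poly m)) = 0.
  rewrite mk_monic_lift poly_eval_lift -[X in residue_class X]mul1r.
  by rewrite residue_class_modulus scale0r.
by rewrite mulr0 add0r.
Qed.

Definition base_change_desc (b : B) : D := poly_eval (class_poly b).

Fact base_change_desc_is_zmod_morphism : zmod_morphism base_change_desc.
Proof.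
move=> x y; rewrite -[x]class_polyK -[y]class_polyK -raddfB /base_change_desc.
by rewrite !poly_eval_class raddfB.
Qed.
Fact base_change_desc_is_monoid_morphism : monoid_morphism base_change_desc.
Proof.
split; first by rewrite -(rmorph1 poly_class) /base_change_desc poly_eval_class rmorph1.
move=> x y; rewrite -[x]class_polyK -[y]class_polyK -rmorphM /base_change_desc.
by rewrite !poly_eval_class rmorphM.
Qed.
HB.instance Definition _ :=
  GRing.isZmodMorphism.Build B D base_change_desc base_change_desc_is_zmod_morphism.
HB.instance Definition _ :=
  GRing.isMonoidMorphism.Build B D base_change_desc base_change_desc_is_monoid_morphism.
Fact base_change_desc_scalable : scalable base_change_desc.
Proof.
move=> c b; rewrite base_change_scaleE rmorphM /= -[c in LHS]residue_polyK residue_scalarE.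
rewrite {1}/base_change_desc poly_eval_class poly_eval_lift residue_polyK.
by rewrite mulr_algl.
Qed.
HB.instance Definition _ :=
  GRing.isScalable.Build residue_field B D *:%R base_change_desc base_change_desc_scalable.
End Universal.

Lemma base_change_quotientE (b : B) :
  b = \sum_(i < size (class_poly b)) base_change_var ^+ i *: base_change_map (class_poly b)`_i.
Proof.
rewrite -{1}[b]class_polyK -{1}[class_poly b]coefK poly_def raddf_sum.
apply: eq_bigr => i _; rewrite -mul_polyC /= (rmorphM poly_class) base_change_scaleE mulrC.
rewrite /base_change_var -(rmorphXn residue_class) /= residue_scalarE.
by rewrite /lift_poly map_polyXn.
Qed.

(** Existence is evaluation at the class of X; uniqueness holds because the image of A spans
    A[X]/(m) over the residue field. *)
Lemma base_change_quotientP :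
  is_base_change (base_change_map : {lrmorphism A -> B | residue_embed \; *:%R}).
Proof.
move=> D g; exists (base_change_desc g : {lrmorphism B -> D}); split.
  move=> a /=; rewrite /base_change_desc poly_eval_class /poly_eval.
  by rewrite map_polyC hornerC.
move=> h' h'g b; rewrite [b]base_change_quotientE !raddf_sum /=.
apply: eq_bigr => i _; rewrite !linearZ /=; congr (_ *: _).
rewrite [LHS]h'g /base_change_desc poly_eval_class /poly_eval.
by rewrite map_polyC hornerC.
Qed.
End BaseChangeQuotient.

Section Algebraic.
Context {k : fieldType} (A : comAlgType k).

(** In A[X] the root u gives m = q (X - u). If deg m > 1, both factors have degree below deg m, so
    they are zero divisors in the base change A[X]/(m). *)
Lemma geom_integral_irreducible_root (m : {poly k}) (u : A) :
  geom_integral_alg A -> monic_irreducible_poly m -> horner_alg u m = 0 ->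
  (size m <= 2)%N.
Proof.
move=> gA mI mu; rewrite leqNgt; apply/negP => m2.
have /factor_theorem[q eq] : root (lift_poly A m) u by apply/eqP.
have Xu0 : ('X - u%:P : {poly A}) != 0 by rewrite monic_neq0 ?monicXsubC.
have sq : size (lift_poly A m) = (size q).+1.
  have q0 : q != 0.
    apply: contraTneq m2 => q0; move: eq; rewrite q0 mul0r.
    move/(congr1 (fun p : {poly A} => size p)).
    by rewrite size_lift_poly size_poly0 => ->.
  by rewrite eq size_Mmonic ?monicXsubC // size_XsubC addn2.
have : poly_class mI q * poly_class mI ('X - u%:P) = 0.
  by rewrite -rmorphM /= -eq; have := poly_class_modulus mI (1 : {poly A}); rewrite mul1r.
case/(gA _ _ _ _ (@base_change_quotientP _ A _ mI)) => /poly_class_eq0 e0.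
  rewrite size_lift_poly in sq; have q0 : q = 0 by apply: e0; rewrite sq.
  rewrite q0 size_poly0 in sq.
  by rewrite sq in m2.
by move: Xu0; rewrite e0 ?eqxx // size_XsubC.
Qed.

Hypothesis domA : forall x y : A, x * y = 0 -> x = 0 \/ y = 0.

(** Take an annihilating polynomial of least degree; as A is a domain, one factor of any
    factorization still annihilates u. *)
Lemma minimal_annihilator (u : A) (P : {poly k}) : P != 0 -> horner_alg u P = 0 ->
  exists2 m, monic_irreducible_poly m & horner_alg u m = 0.
Proof.
move=> P0 Pu.
pose good n := `[< exists p : {poly k}, [/\ p != 0, horner_alg u p = 0 & size p = n] >].
have exg : exists n, good n by exists (size P); apply/asboolP; exists P.
case: (ex_minnP exg) => n /asboolP[m0 [m00 m0u sm0]] minn.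
pose m := (lead_coef m0)^-1 *: m0.
have lc0 : (lead_coef m0)^-1 != 0 by rewrite invr_eq0 lead_coef_eq0.
have mu : horner_alg u m = 0 by rewrite /m -mul_polyC rmorphM /= m0u mulr0.
have sm : size m = n by rewrite size_scale.
have m_neq0 : m != 0 by rewrite -size_poly_eq0 sm -sm0 size_poly_eq0.
have min p : p != 0 -> horner_alg u p = 0 -> (size m <= size p)%N.
  by move=> p0 pu; rewrite sm; apply: minn; apply/asboolP; exists p.
exists m => //; split; last first.
  by apply/monicP; rewrite lead_coefZ mulVf // lead_coef_eq0.
split.
  rewrite ltnNge; apply/negP => /size1_polyC em.
  have c0 : m`_0 != 0 by apply: contraNneq m_neq0 => c0; rewrite em c0.
  move: mu; rewrite em horner_algC => /(congr1 (fun x => (m`_0)^-1 *: x)).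
  by rewrite scalerA mulVf // scale1r scaler0 => /eqP; rewrite oner_eq0.
move=> q sq qm; have /dvdpP[r er] := qm.
have [r0 q0] : r != 0 /\ q != 0.
  by apply/andP; rewrite -negb_or -mulf_eq0 -er.
have : horner_alg u r * horner_alg u q = 0 by rewrite -rmorphM /= -er.
case/domA=> [ru|qu]; last by rewrite -(dvdp_size_eqp qm) eqn_leq dvdp_leq //= min.
have := min _ r0 ru; rewrite er size_mul //.
move: sq; have := size_poly_eq0 q; rewrite (negbTE q0); case: (size q) => [|[|s]] //= _ _.
by rewrite !addnS /= -addSn -ltn_subRL subnn.
Qed.

Lemma geom_integral_algebraic (u : A) (P : {poly k}) : geom_integral_alg A ->
  P != 0 -> horner_alg u P = 0 -> exists c, u = c%:A.
Proof.
move=> gA P0 /(minimal_annihilator P0)[m mI mu].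
have := geom_integral_irreducible_root gA mI mu.
have [[m1 _] mm] := mI; rewrite leq_eqVlt ltnNge m1 orbF => /eqP sm.
exists (- m`_0).
have em : m = 'X + (m`_0)%:P.
  apply/polyP => i; rewrite coefD coefX coefC.
  case: i => [|[|i]] //=; rewrite ?add0r ?addr0 //.
    by have := monicP mm; rewrite lead_coefE sm.
  by rewrite nth_default // sm.
move: mu; rewrite em rmorphD /= horner_algX horner_algC -em => /eqP.
by rewrite addr_eq0 scaleNr => /eqP.
Qed.
End Algebraic.

(** * Poles at infinity *)

Section Cover.
Context {k : fieldType} (C : P1_cover k).
Local Notation t := (param0 C).
Local Notation s := (param1 C).
Local Notation r0 := (res0 C).
Local Notation r1 := (res1 C).
Local Notation pexp := (param_exp C).

Lemma param_expS (m : int) : pexp (m + 1) = pexp m * r0 t.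
Proof.
case: m => [d|[|d]].
- by rewrite -PoszD addn1 /= exprSr.
- by rewrite /= expr1 mulrC res_paramK.
have -> : Negz d.+1 + 1 = Negz d by lia.
by rewrite /= [in RHS]exprSr -mulrA [r1 s * _]mulrC res_paramK mulr1.
Qed.

Lemma param_exp_nat (d : nat) : pexp d = r0 t ^+ d.
Proof. by []. Qed.

Lemma param_expD_nat (m : int) (d : nat) : pexp (m + d%:Z) = pexp m * r0 t ^+ d.
Proof.
elim: d => [|d IHd]; first by rewrite addr0 mulr1.
by rewrite -addn1 PoszD addrA param_expS IHd addn1 exprSr mulrA.
Qed.

Lemma param_expN_nat (d : nat) : pexp (- d%:Z) = r1 s ^+ d.
Proof. by case: d => [|d] //; rewrite oppr0. Qed.

Lemma res_paramXK d : r0 t ^+ d * r1 s ^+ d = 1.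
Proof. by rewrite -exprMn_comm ?res_paramK ?expr1n //; apply: mulrC. Qed.

Lemma param_expD (m m' : int) : pexp (m + m') = pexp m * pexp m'.
Proof.
have pN (z : int) (d : nat) : pexp (z - d%:Z) = pexp z * pexp (- d%:Z).
  rewrite -[z in RHS](subrK d%:Z z) param_expD_nat param_expN_nat -mulrA.
  by rewrite res_paramXK mulr1.
case: m' => d; first exact: param_expD_nat.
by rewrite NegzE pN.
Qed.

Lemma res1_horner (q : {poly k}) :
  r1 (horner_alg s q) = \sum_(i < size q) q`_i *: pexp (- (i : nat)%:Z).
Proof.
rewrite -{1}[q]coefK poly_def !raddf_sum /=; apply: eq_bigr => i _.
rewrite -mul_polyC rmorphM /= horner_algC rmorphXn /= horner_algX.
by rewrite mulr_algl linearZ rmorphXn param_expN_nat.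
Qed.

Lemma res0_horner (q : {poly k}) :
  r0 (horner_alg t q) = \sum_(i < size q) q`_i *: pexp i.
Proof.
rewrite -{1}[q]coefK poly_def !raddf_sum /=; apply: eq_bigr => i _.
rewrite -mul_polyC rmorphM /= horner_algC rmorphXn /= horner_algX.
by rewrite mulr_algl linearZ rmorphXn.
Qed.

Hypothesis dom0 : forall x y : chart0 C, x * y = 0 -> x = 0 \/ y = 0.

Lemma param0_neq0 : t != 0.
Proof.
apply/eqP => t0; have := res_paramK C; rewrite t0 rmorph0 mul0r => /eqP.
by rewrite eq_sym oner_eq0.
Qed.

Lemma mul_eq0_chart0 (x y : chart0 C) : x != 0 -> x * y = 0 -> y = 0.
Proof. by move=> x0 /dom0[] // e; rewrite e eqxx in x0. Qed.

Lemma expr_neq0_chart0 (x : chart0 C) d : x != 0 -> x ^+ d != 0.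
Proof.
move=> x0; elim: d => [|d IHd]; first by rewrite oner_neq0.
by rewrite exprS; apply: contra_neq IHd => /(mul_eq0_chart0 x0).
Qed.

Lemma res0_inj : injective r0.
Proof.
move=> x y /eqP; rewrite -subr_eq0 -raddfB => /eqP.
case: (res0_loc C) => _ _ /[apply] -[m] /(mul_eq0_chart0 (expr_neq0_chart0 m param0_neq0)).
by move/eqP; rewrite subr_eq0 => /eqP.
Qed.

Variables (n : nat) (e : 'I_n -> chart0 C) (f : 'I_n -> chart1 C) (a : 'I_n -> int).
Hypothesis He : is_poly_basis t e.
Hypothesis Hf : is_poly_basis s f.
Hypothesis Hfe : forall i, r1 (f i) = pexp (- a i) * r0 (e i).

Definition basis_comb (p : 'I_n -> {poly k}) : chart0 C := \sum_i horner_alg t (p i) * e i.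

Local Notation comb := basis_comb.

Lemma comb_inj p q : comb p = comb q -> p =1 q.
Proof.
move=> epq i; have [r [_ ur]] := He (comb p).
have ff (p' : 'I_n -> {poly k}) : comb p' = \sum_i horner_alg t (finfun p' i) * e i.
  by apply: eq_bigr => j _; rewrite ffunE.
have rp := ur (finfun p) (ff p); have rq := ur (finfun q) (etrans epq (ff q)).
by move: rp; rewrite rq => /(congr1 (fun h : {ffun _} => h i)); rewrite !ffunE.
Qed.

Lemma combP x : exists p, x = comb p.
Proof. by have [p [ep _]] := He x; exists p. Qed.

Lemma combZ q p : horner_alg t q * comb p = comb (fun i => q * p i).
Proof. by rewrite mulr_sumr; apply: eq_bigr => i _; rewrite rmorphM mulrA. Qed.

Lemma comb0 : comb (fun=> 0) = 0.
Proof. by rewrite /comb big1 // => i _; rewrite rmorph0 mul0r. Qed.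

Lemma comb_neq0 p i : p i != 0 -> comb p != 0.
Proof. by move=> pi0; apply: contra_neq pi0 => e0; rewrite (comb_inj (etrans e0 (esym comb0))). Qed.

Lemma neq0_comb p : comb p != 0 -> exists i, p i != 0.
Proof.
move=> p0; apply/existsP; apply: contraNT p0 => /existsPn p0.
by rewrite /comb big1 // => i _; have /negPn/eqP-> := p0 i; rewrite rmorph0 mul0r.
Qed.

(** On the overlap s^j f_i = t^(-a_i - j) e_i, so a large t^N clears the poles and leaves exponents
    at most N - a_i. *)
Lemma res1_comb x : exists N0 : nat, forall N : nat, (N0 <= N)%N -> exists p,
  r0 t ^+ N * r1 x = r0 (comb p) /\
  forall i (j : nat), (p i)`_j != 0 -> j%:Z + a i <= N%:Z.
Proof.
have [q [-> _]] := Hf x.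
pose M := (\sum_i (size (q i) + absz (a i)))%N; exists M => N MN.
have leN i (j : 'I_(size (q i))) : 0 <= N%:Z - a i - (j : nat)%:Z.
  have : (size (q i) + absz (a i) <= M)%N by rewrite /M (bigD1 i) //= leq_addr.
  by have := ltn_ord j; lia.
exists (fun i => \sum_(j < size (q i)) (q i)`_j *: 'X^(absz (N%:Z - a i - (j : nat)%:Z)%R)); split.
  rewrite /comb !raddf_sum /= mulr_sumr; apply: eq_bigr => i _.
  rewrite !rmorphM /= Hfe res1_horner !raddf_sum /= !mulr_suml mulr_sumr.
  apply: eq_bigr => j _.
  rewrite -mul_polyC rmorphM /= horner_algC rmorphXn /= horner_algX mulr_algl linearZ rmorphXn /=.
  rewrite -(param_exp_nat (absz _)) gez0_abs ?leN // -!scalerAl -!scalerAr; congr (_ *: _).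
  rewrite !mulrA -param_exp_nat -!param_expD; congr (pexp _ * _); lia.
move=> i j; rewrite coef_sum => nz.
have /existsP[l /eqP lP] : [exists l : 'I_(size (q i)), j == absz (N%:Z - a i - (l : nat)%:Z)%R].
  apply: contraNT nz => /existsPn nl; rewrite big1 // => l _.
  by rewrite coefZ coefXn (negbTE (nl l)) mulr0.
by rewrite lP gez0_abs ?leN //; lia.
Qed.

(** A monomial t^(j+c) e_i is regular at infinity only if j + c + a_i <= 0, and distinct monomials
    cannot cancel: multiply by t^N and compare coefficients in the basis e. *)
Lemma coef_comb_bound (c : int) p x : r0 (comb p) * pexp c = r1 x ->
  forall i (j : nat), (p i)`_j != 0 -> j%:Z + c + a i <= 0.
Proof.
move=> epx i j nz; have [N0 hN] := res1_comb x.
pose N := (N0 + absz c)%N.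
have [q [eq qN]] := hN N (leq_addr _ _).
have Nc : 0 <= N%:Z + c by rewrite /N; lia.
have : comb (fun i => 'X^(absz (N%:Z + c)%R) * p i) = comb q.
  apply: res0_inj; rewrite -eq -epx -combZ rmorphM /= rmorphXn /= horner_algX rmorphXn.
  by rewrite mulrCA -!param_exp_nat -param_expD gez0_abs // mulrC.
move/comb_inj/(_ i) => ei.
have : (q i)`_(j + absz (N%:Z + c)%R) != 0 by rewrite -ei coefXnM addnK ltnNge leq_addl.
by move/qN; lia.
Qed.
End Cover.

(** The exchange bound in V / U: the matrix writing the [b i] through the [b' j] modulo U has
    independent rows. U is a predicate because V may have infinite dimension. *)
Lemma card_basis_mod_leq (k : fieldType) (V : lmodType k) (U : V -> Prop)
    (I J : finType) (b : I -> V) (b' : J -> V) :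
  (forall c x y, U x -> U y -> U (c *: x + y)) -> U 0 ->
  (forall c : I -> k, U (\sum_i c i *: b i) -> forall i, c i = 0) ->
  (forall i, exists d : J -> k, U (b i - \sum_j d j *: b' j)) ->
  (#|I| <= #|J|)%N.
Proof.
move=> UL U0 indep /choice[d dP].
pose M : 'M[k]_(#|I|, #|J|) := \matrix_(i, j) d (enum_val i) (enum_val j).
suff : row_free M by move=> /eqP <-; apply: rank_leq_col.
apply: inj_row_free => v vM.
suff v0 i : v 0 (enum_rank i) = 0.
  by apply/rowP => i; rewrite mxE -[i]enum_valK v0.
apply: (indep (fun i => v 0 (enum_rank i))) => {i}.
have Usum (F : I -> V) : (forall i, U (F i)) -> forall c : I -> k, U (\sum_i c i *: F i).
  by move=> UF c; elim/big_rec: _ => // i x _ Ux; apply: UL.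
suff -> : \sum_i v 0 (enum_rank i) *: b i =
    \sum_i v 0 (enum_rank i) *: (b i - \sum_j d i j *: b' j) by exact: Usum.
apply/eqP; rewrite -subr_eq0 -sumrB; apply/eqP.
under eq_bigr => x _ do rewrite -scalerBr opprB addrC subrK scaler_sumr.
rewrite exchange_big big1 // => j _ /=.
under eq_bigr => x _ do rewrite scalerA.
rewrite -scaler_suml; have /rowP/(_ (enum_rank j)) := vM.
rewrite !mxE => e; rewrite [X in X *: _](_ : _ = 0) ?scale0r // -[RHS]e.
rewrite (reindex_onto enum_val enum_rank) /=; last by move=> x _; rewrite enum_rankK.
apply: eq_big => [x|x _]; first by rewrite enum_valK eqxx.
by rewrite enum_valK !mxE enum_rankK.
Qed.

(** * Structure constants and global sections *)

Section Invariants.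
Context {k : fieldType} (C : P1_cover k).
Local Notation t := (param0 C).
Local Notation s := (param1 C).
Local Notation r0 := (res0 C).
Local Notation r1 := (res1 C).
Local Notation pexp := (param_exp C).
Hypothesis dom0 : forall x y : chart0 C, x * y = 0 -> x = 0 \/ y = 0.
Variables (n : nat) (e : 'I_n -> chart0 C) (f : 'I_n -> chart1 C) (a : 'I_n -> int).
Hypothesis He : is_poly_basis t e.
Hypothesis Hf : is_poly_basis s f.
Hypothesis Hfe : forall i, r1 (f i) = pexp (- a i) * r0 (e i).

Local Notation comb := (basis_comb e).
Local Notation bound := (coef_comb_bound dom0 He Hf Hfe).

Lemma comb_delta i : comb (fun j => (j == i)%:R) = e i.
Proof.
rewrite /basis_comb (bigD1 i) //= eqxx rmorph1 mul1r big1 ?addr0 // => j /negbTE->.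
by rewrite rmorph0 mul0r.
Qed.

(** As f_i f_j = t^(-a_i - a_j) e_i e_j is regular at infinity, a term t^m e_l of e_i e_j has m <=
    a_i + a_j - a_l. *)
Lemma structure_constant_eq0 i j l p : e i * e j = comb p ->
  a i + a j < a l -> p l = 0.
Proof.
move=> eij lt; apply/eqP; rewrite -lead_coef_eq0; apply: contraTT lt => nz.
have H : r0 (comb p) * pexp (- (a i + a j)) = r1 (f i * f j).
  by rewrite -eij !rmorphM /= !Hfe opprD param_expD [RHS]mulrACA mulrC.
by have := bound H nz; lia.
Qed.

Definition global_section z := exists x, r0 z = r1 x.

Lemma global_section1 : global_section 1.
Proof. by exists 1; rewrite !rmorph1. Qed.

Lemma global_sectionM z w : global_section z -> global_section w -> global_section (z * w).
Proof. by move=> [x ex] [y ey]; exists (x * y); rewrite !rmorphM /= ex ey. Qed.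

Lemma global_sectionX z d : global_section z -> global_section (z ^+ d).
Proof.
move=> gz; elim: d => [|d IHd]; first exact: global_section1.
by rewrite exprS; apply: global_sectionM.
Qed.

Lemma global_section_coef p : global_section (comb p) ->
  forall i (j : nat), (p i)`_j != 0 -> j%:Z + a i <= 0.
Proof.
move=> [x ex] i j nz; have H : r0 (comb p) * pexp 0 = r1 x by rewrite mulr1.
by have := bound H nz; rewrite addr0.
Qed.

(** The minimum is at most 0 because 1 is a global section. If it were -m < 0, then t^m e_i0 would
    be a global section whose square has a term t^j e_i with j >= 2 m, so 2 m + a_i <= 0, against
    a_i >= -m. *)
Lemma min_scrollar_eq0 i0 : (forall i, a i0 <= a i) -> a i0 = 0.
Proof.
move=> mina; apply/eqP; rewrite eq_le; apply/andP; split.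
  have [p ep] := combP He 1.
  have [i pi] : exists i, p i != 0 by apply: (neq0_comb (e := e)); rewrite -ep oner_neq0.
  have := global_section_coef (p := p) _ (i := i) (j := (size (p i)).-1).
  rewrite -ep -lead_coefE lead_coef_eq0 => /(_ global_section1 pi).
  by have := mina i; lia.
rewrite leNgt; apply/negP => a0; pose m := absz (a i0).
have em : a i0 = - m%:Z by rewrite /m; lia.
have gs : global_section (t ^+ m * e i0).
  by exists (f i0); rewrite Hfe em opprK rmorphM rmorphXn param_exp_nat.
have e0 : e i0 != 0 by rewrite -comb_delta (comb_neq0 He (i := i0)) // eqxx oner_neq0.
have [p ep] := combP He (e i0 ^+ 2).
have [i pi] : exists i, p i != 0.
  by apply: (neq0_comb (e := e)); rewrite -ep expr_neq0_chart0.
have e2 : (t ^+ m * e i0) ^+ 2 = comb (fun j => 'X^(m * 2) * p j).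
  by rewrite exprMn -exprM ep -combZ rmorphXn /= horner_algX.
have := global_section_coef (p := fun j => 'X^(m * 2) * p j) _ (i := i)
  (j := (m * 2 + (size (p i)).-1)%N).
rewrite -e2 coefXnM ltnNge leq_addr /= addKn -lead_coefE lead_coef_eq0.
move=> /(_ (global_sectionX _ gs) pi); have := mina i; lia.
Qed.

Hypothesis a_ge0 : forall i, 0 <= a i.

Lemma global_section_span z : global_section z -> exists c : 'I_n -> k, z = \sum_i c i *: e i.
Proof.
have [p ->] := combP He z => gz; exists (fun i => (p i)`_0).
apply: eq_bigr => i _; rewrite -mulr_algl -(horner_algC t); congr (horner_alg _ _ * _).
apply/polyP => -[|j]; rewrite coefC //=; apply/eqP/negPn/negP => nz.
by have := global_section_coef gz nz; have := a_ge0 i; lia.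
Qed.

(** The n + 1 powers 1, u, ..., u^n lie in the k-span of the n elements e_i, so they are linearly
    dependent. *)
Lemma global_section_algebraic u : global_section u ->
  exists2 P : {poly k}, P != 0 & horner_alg u P = 0.
Proof.
move=> gu; have /choice[c cP] : forall d, exists c : 'I_n -> k, u ^+ d = \sum_i c i *: e i.
  by move=> d; apply: global_section_span; apply: global_sectionX.
pose M : 'M[k]_(n.+1, n) := \matrix_(j, i) c j i.
have [v v0 vM] : exists2 v : 'rV_n.+1, v != 0 & v *m M = 0.
  apply/not_exists2P => nov; have : row_free M.
    by apply: inj_row_free => v vM; have [/negP/negPn/eqP|] := nov v.
  by move/eqP => rM; have := rank_leq_col M; rewrite rM ltnn.
exists (rVpoly v).
  by apply: contra_neq v0 => e0; rewrite -[v]rVpolyK e0 raddf0.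
rewrite [rVpoly v]poly_def raddf_sum /=.
transitivity (\sum_(j < n.+1) v 0 j *: u ^+ j).
  apply: eq_bigr => j _; rewrite -mul_polyC rmorphM /= horner_algC rmorphXn /= horner_algX.
  rewrite mulr_algl; congr (_ *: _).
  by case: insubP => [l _ /val_inj-> // | ]; rewrite ltn_ord.
under eq_bigr => j _ do rewrite cP scaler_sumr.
rewrite exchange_big big1 // => i _ /=.
under eq_bigr => j _ do rewrite scalerA.
rewrite -scaler_suml; have /rowP/(_ i) := vM; rewrite !mxE => e0.
rewrite [X in X *: _](_ : _ = 0) ?scale0r // -[RHS]e0.
by apply: eq_bigr => j _; rewrite mxE.
Qed.

(** This encodes H^0(O_C) = k: if a_i = 0 then e_i is a global section, hence algebraic over k,
    hence constant; a basis cannot contain two constants. *)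
Lemma scrollar_eq0_unique i0 i1 : geom_integral_alg (chart0 C) ->
  a i0 = 0 -> a i1 = 0 -> i0 = i1.
Proof.
move=> gA a0 a1; apply/eqP/negPn/negP => i01.
have scal i : a i = 0 -> exists c, e i = c%:A.
  move=> ai; have [|P P0 Pe] := @global_section_algebraic (e i).
    by exists (f i); rewrite Hfe ai oppr0 param_exp_nat mul1r.
  exact: (@geom_integral_algebraic _ _ dom0 (e i) P gA P0 Pe).
have [c0 e0] := scal _ a0; have [c1 e1] := scal _ a1.
have e_neq0 i : e i != 0 by rewrite -comb_delta (comb_neq0 He (i := i)) // eqxx oner_neq0.
have c0_neq0 : c0 != 0 by apply: contraNneq (e_neq0 i0) => c00; rewrite e0 c00 scale0r.
suff : comb (fun j => if j == i1 then c0%:P else (if j == i0 then - c1%:P else 0)) = comb (fun=> 0).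
  by move/(comb_inj He)/(_ i1)/eqP; rewrite eqxx polyC_eq0 (negbTE c0_neq0).
rewrite comb0 /basis_comb (bigD1 i1) //= eqxx (bigD1 i0) //= eqxx (negbTE i01).
rewrite rmorphN /= !horner_algC e0 e1 !mulr_algl !scalerA mulNr [(c0 * c1)]mulrC addrA.
rewrite mulr_algl scalerA subrr add0r big1 // => j /andP[/negbTE-> /negbTE->].
by rewrite rmorph0 mul0r.
Qed.
End Invariants.

(** * The genus *)

Section Cech.
Context {k : fieldType} (C : P1_cover k).
Local Notation t := (param0 C).
Local Notation s := (param1 C).
Local Notation r0 := (res0 C).
Local Notation r1 := (res1 C).
Local Notation pexp := (param_exp C).
Hypothesis dom0 : forall x y : chart0 C, x * y = 0 -> x = 0 \/ y = 0.
Variables (n : nat) (e : 'I_n -> chart0 C) (f : 'I_n -> chart1 C) (a : 'I_n -> int).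
Hypothesis He : is_poly_basis t e.
Hypothesis Hf : is_poly_basis s f.
Hypothesis Hfe : forall i, r1 (f i) = pexp (- a i) * r0 (e i).
Hypothesis a_ge0 : forall i, 0 <= a i.

Local Notation comb := (basis_comb e).

Definition coboundary (y : overlap C) : Prop := exists a0 a1, y = r0 a0 - r1 a1.

Lemma coboundary_res0 x : coboundary (r0 x).
Proof. by exists x, 0; rewrite raddf0 subr0. Qed.

Lemma coboundary_res1 x : coboundary (r1 x).
Proof. by exists 0, (- x); rewrite raddf0 raddfN sub0r opprK. Qed.

Lemma coboundary_linear (c : k) x y : coboundary x -> coboundary y -> coboundary (c *: x + y).
Proof.
move=> [x0 [x1 ->]] [y0 [y1 ->]]; exists (c *: x0 + y0), (c *: x1 + y1).
by rewrite (linearP r0) (linearP r1) scalerBr opprD addrACA.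
Qed.

Lemma coboundary0 : coboundary 0.
Proof. by rewrite -(raddf0 r0); apply: coboundary_res0. Qed.

(* (i, m) stands for t^-(m+1) e_i.  A monomial t^z e_i is a section over the   *)
(* first chart if z >= 0 and over the second if z <= -a_i.                      *)
Definition cech_index : finType := {i : 'I_n & 'I_(absz (a i)).-1}.

Definition cech_monomial (x : cech_index) : overlap C :=
  pexp (- (tagged x).+1%:Z) * r0 (e (tag x)).

(** After multiplication by t^N, the coefficient of e_i has exponents at least N from the first
    chart and at most N - a_i from the second; N - m - 1 lies strictly between. *)
Lemma cech_monomial_free (c : cech_index -> k) :
  coboundary (\sum_x c x *: cech_monomial x) -> forall x, c x = 0.
Proof.
move=> [a0 [a1 ea]] [i m].
have [N0 hN] := res1_comb Hf Hfe a1.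
pose N := (N0 + \sum_j absz (a j))%N.
have leaN j : (absz (a j) <= N)%N by rewrite /N (bigD1 j) //= addnCA leq_addr.
have [p [ep pN]] := hN N (leq_addr _ _).
have [P eP] := combP He a0.
pose c' j (l : 'I_(absz (a j)).-1) := c (Tagged (fun j => 'I_(absz (a j)).-1) l).
pose q j := \sum_(l < (absz (a j)).-1) c' j l *: 'X^(N - l.+1).
have ltl j (l : 'I_(absz (a j)).-1) : (l.+1 < N)%N.
  by have := ltn_ord l; have := leaN j; lia.
have : comb q = comb (fun j => 'X^N * P j - p j).
  have -> : comb (fun j => 'X^N * P j - p j) = t ^+ N * a0 - comb p.
    have -> : t ^+ N = horner_alg t 'X^N by rewrite rmorphXn /= horner_algX.
    rewrite eP combZ /basis_comb -sumrB.
    by apply: eq_bigr => j _; rewrite rmorphB mulrBl.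
  apply: (res0_inj dom0); rewrite raddfB /= rmorphM /= -ep rmorphXn /= -mulrBr -ea.
  rewrite /basis_comb raddf_sum mulr_sumr /=.
  transitivity (\sum_j \sum_(l < (absz (a j)).-1) c' j l *: (r0 t ^+ (N - l.+1) * r0 (e j))).
    apply: eq_bigr => j _; rewrite rmorphM raddf_sum raddf_sum mulr_suml /=.
    apply: eq_bigr => l _; rewrite -mul_polyC rmorphM /= horner_algC rmorphXn /= horner_algX.
    by rewrite mulr_algl linearZ rmorphXn -scalerAl.
  rewrite (sig_big_dep xpredT (fun _ _ => true)
    (fun j l => c' j l *: (r0 t ^+ (N - l.+1) * r0 (e j)))) /=.
  apply: eq_bigr => -[j l] _; rewrite /cech_monomial /= -scalerAr mulrA; congr (_ *: (_ * _)).
  rewrite -(param_exp_nat C N) -(param_exp_nat C (N - l.+1)).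
  rewrite -(param_expN_nat C l.+1) -param_expD; congr (pexp _).
  by have := ltl j l; lia.
move/(comb_inj He)/(_ i)/(congr1 (fun r : {poly k} => r`_(N - m.+1))).
rewrite coefB coefXnM ltn_subrL /= (leq_ltn_trans _ (ltl i m)) //= sub0r.
rewrite coef_sum (bigD1 m) //= coefZ coefXn eqxx mulr1 big1 ?addr0; last first.
  move=> l lm; rewrite coefZ coefXn; case: eqP => [E|]; rewrite ?mulr0 //.
  case/eqP: lm; apply: val_inj => /=; have := ltl i l; have := ltl i m; lia.
rewrite -[X in _ -> X = _]/(c' i m) => ->; apply/eqP; rewrite oppr_eq0; apply/negPn/negP => nz.
have := pN i _ nz; have := ltn_ord m; have := ltl i m; have := a_ge0 i; lia.
Qed.

Lemma cech_monomial_span y : exists d : cech_index -> k,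
  coboundary (y - \sum_x d x *: cech_monomial x).
Proof.
pose sp z := exists d : cech_index -> k, coboundary (z - \sum_x d x *: cech_monomial x).
have spL (c : k) x z : sp x -> sp z -> sp (c *: x + z).
  move=> [d1 h1] [d2 h2]; exists (fun x => c * d1 x + d2 x).
  suff -> : \sum_x0 (c * d1 x0 + d2 x0) *: cech_monomial x0 =
      c *: (\sum_x0 d1 x0 *: cech_monomial x0) + \sum_x0 d2 x0 *: cech_monomial x0.
    by rewrite opprD addrACA -scalerBr; apply: coboundary_linear.
  rewrite scaler_sumr -big_split; apply: eq_bigr => j _.
  by rewrite scalerDl scalerA.
have spcob z : coboundary z -> sp z.
  move=> hz; exists (fun=> 0); rewrite big1 ?subr0 // => j _; exact: scale0r.
have sp_sum (I : finType) (F : I -> overlap C) (c : I -> k) :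
    (forall i, sp (F i)) -> sp (\sum_i c i *: F i).
  move=> spF; elim/big_rec: _ => [|i x _ spx]; first exact/spcob/coboundary0.
  exact: spL.
have spmon (z : int) i : sp (pexp z * r0 (e i)).
  have [z0 | z0] := leP 0 z.
    apply: spcob; have -> : pexp z * r0 (e i) = r0 (t ^+ absz z * e i).
      by rewrite rmorphM rmorphXn -param_exp_nat gez0_abs.
    exact: coboundary_res0.
  have [za | za] := leP z (- a i).
    apply: spcob; have -> : pexp z * r0 (e i) = r1 (s ^+ absz (z + a i) * f i).
      rewrite rmorphM rmorphXn /= -param_expN_nat Hfe mulrA -param_expD.
      by congr (pexp _ * _); lia.
    exact: coboundary_res1.
  have lt : ((absz z).-1 < (absz (a i)).-1)%N by lia.
  pose x : cech_index := Tagged (fun j => 'I_(absz (a j)).-1) (Ordinal lt).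
  exists (fun x' => (x' == x)%:R); rewrite (bigD1 x) //= eqxx scale1r big1; last first.
    by move=> j /negbTE->; rewrite scale0r.
  have -> : cech_monomial x = pexp z * r0 (e i).
    by rewrite /cech_monomial; congr (pexp _ * _); change (- (absz z).-1.+1%:Z = z); lia.
  rewrite addr0 subrr.
  exact: coboundary0.
(* An element of the overlap is s^N times one of the first chart, hence a combination of the t^z
   e_i. *)
have [_ /(_ y)[b [N ey]] _] := res0_loc C.
have [p eb] := combP He b; rewrite eb in ey.
have -> : y = r1 s ^+ N * r0 (comb p).
  by rewrite -ey mulrA [r1 s ^+ N * _]mulrC res_paramXK mul1r.
rewrite /basis_comb raddf_sum mulr_sumr.
have one (F : 'I_n -> overlap C) : (forall i, sp (F i)) -> sp (\sum_i F i).
  move=> spF; under eq_bigr => i _ do rewrite -[F i]scale1r.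
  exact: sp_sum.
apply: one => i /=; rewrite rmorphM /= res0_horner mulr_suml mulr_sumr.
under eq_bigr => j _ do rewrite -scalerAl -scalerAr mulrA -param_expN_nat -param_expD.
exact: sp_sum.
Qed.

Lemma genus_card g : has_genus C g -> g = #|cech_index|.
Proof.
move=> [b bP].
have bspan y : exists d : 'I_g -> k, coboundary (y - \sum_i d i *: b i).
  have [c [[a0 [a1 ->]] _]] := bP y; exists c.
  by rewrite addrAC subrr add0r; exists a0, a1.
have bfree (c : 'I_g -> k) : coboundary (\sum_i c i *: b i) -> forall i, c i = 0.
  move=> [a0 [a1 ea]] i; have [c0 [_ uc]] := bP (\sum_i c i *: b i).
  have e1 := uc (finfun c); have e2 := uc (finfun (fun=> 0)).
  suff : finfun c = finfun (fun=> 0) :> {ffun 'I_g -> k}.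
    by move/ffunP/(_ i); rewrite !ffunE.
  rewrite -e1; last first.
    exists 0, 0; rewrite (raddf0 r0) (raddf0 r1) subr0 addr0.
    by apply: eq_bigr => j _; rewrite ffunE.
  apply: e2; exists a0, a1; rewrite -ea [X in _ = X + _]big1 ?add0r // => j _.
  by rewrite ffunE scale0r.
have le1 := card_basis_mod_leq coboundary_linear coboundary0 bfree
  (fun i => cech_monomial_span (b i)).
have le2 := card_basis_mod_leq coboundary_linear coboundary0 cech_monomial_free
  (fun x => bspan (cech_monomial x)).
by apply/eqP; move: le1 le2; rewrite card_ord eqn_leq => -> ->.
Qed.

(** The truncated predecessor is the dimension of H^1(P^1, O(-a_i)), as a_i >= 0. *)
Lemma genus_sum g : has_genus C g -> g = (\sum_i (absz (a i)).-1)%N.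
Proof.
move/genus_card ->; rewrite card_tagged sumnE big_map big_enum /=.
by apply: eq_bigr => i _; rewrite card_ord.
Qed.
End Cech.

(** * The flag in the function field *)

Lemma ratfun_fraction (k : fieldType) (x : ratfun k) :
  exists p q : {poly k}, q != 0 /\ tofrac q * x = tofrac p.
Proof.
exists (\n_(repr x)), (\d_(repr x)); split; first exact: denom_ratioP.
rewrite -{2}[x]reprK !piE; apply/eqmodP => /=.
rewrite FracField.equivfE /= !numden_Ratio ?mulf_neq0 ?oner_neq0 ?denom_ratioP //.
by rewrite !mul1r mulr1 mulrC.
Qed.

Lemma prodv_span_subv (F : fieldType) (L : fieldExtType F) (X Y : seq L) (W : {vspace L}) :
  {in X & Y, forall x y, x * y \in W} -> (<<X>> * <<Y>> <= W)%VS.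
Proof.
elim: X => [|x X IHX] XYW; first by rewrite span_nil prod0v sub0v.
rewrite span_cons prodvDl subv_add IHX ?andbT; last first.
  by move=> u w uX wY; rewrite XYW // in_cons uX orbT.
have {IHX} xYW y : y \in Y -> x * y \in W by move=> yY; rewrite XYW // mem_head.
elim: Y xYW {XYW} => [|y Y IHY] xYW; first by rewrite span_nil prodv0 sub0v.
rewrite span_cons prodvDr subv_add prodv_line -memvE xYW ?mem_head // IHY // => w wY.
by rewrite xYW // in_cons wY orbT.
Qed.

Section FunctionField.
Context {k : fieldType} (C : P1_cover k) {L : fieldExtType (ratfun k)}.
Variable phi : {rmorphism chart0 C -> L}.
Hypothesis phi_ff : is_function_field phi.
Variables (n : nat) (e : 'I_n -> chart0 C).
Hypothesis He : is_poly_basis (param0 C) e.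

Lemma function_field_domain (x y : chart0 C) : x * y = 0 -> x = 0 \/ y = 0.
Proof.
have [phi_inj _ _] := phi_ff.
move/(congr1 phi)/eqP; rewrite rmorphM rmorph0 mulf_eq0.
by case/orP=> /eqP z0; [left | right]; apply: phi_inj; rewrite z0 rmorph0.
Qed.

Definition basis_image : n.-tuple L := [tuple phi (e i) | i < n].

Lemma nth_basis_image (i : 'I_n) : basis_image`_i = phi (e i).
Proof. by rewrite -tnth_nth tnth_mktuple. Qed.

Lemma phi_comb p : phi (basis_comb e p) = \sum_i (tofrac (p i) : ratfun k) *: phi (e i).
Proof.
have [_ phit _] := phi_ff.
by rewrite /basis_comb raddf_sum /=; apply: eq_bigr => i _; rewrite rmorphM /= phit mulr_algl.
Qed.

(** Multiplied by the product of its denominators, a relation over k(t) becomes one over k[t], where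
    e is a basis. *)
Lemma basis_image_free : free basis_image.
Proof.
apply/freeP => c c0 i.
have /choice[pq pqP] : forall i, exists pq : {poly k} * {poly k},
    pq.2 != 0 /\ tofrac pq.2 * c i = tofrac pq.1.
  by move=> j; have [p [q [q0 E]]] := ratfun_fraction (c j); exists (p, q).
pose d := \prod_j (pq j).2.
pose P j := (pq j).1 * \prod_(l | l != j) (pq l).2.
have cP j : tofrac d * c j = tofrac (P j).
  by rewrite /d (bigD1 j) //= rmorphM mulrAC (proj2 (pqP j)) /P rmorphM.
have [phi_inj _ _] := phi_ff.
have : basis_comb e P = basis_comb e (fun=> 0).
  apply: phi_inj; rewrite !phi_comb.
  transitivity (tofrac d *: \sum_j c j *: basis_image`_j : L).
    by rewrite scaler_sumr; apply: eq_bigr => j _; rewrite nth_basis_image scalerA cP.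
  by rewrite c0 scaler0 big1 // => j _; rewrite rmorph0 scale0r.
move/(comb_inj He)/(_ i) => Pi.
have := cP i; rewrite Pi rmorph0 => /eqP; rewrite mulf_eq0 tofrac_eq0 => /orP[|/eqP //].
by rewrite prodf_seq_eq0 => /hasP[j _ /=]; rewrite (negbTE (proj1 (pqP j))).
Qed.

Definition basis_flag (i : nat) : {vspace L} := <<take i.+1 basis_image>>.

Lemma dim_basis_flag i : (i < n)%N -> \dim (basis_flag i) = i.+1.
Proof.
move=> lti; have fr : free (take i.+1 basis_image).
  by have := basis_image_free; rewrite -{1}(cat_take_drop i.+1 basis_image) => /catl_free.
by rewrite (eqP fr) size_takel // size_tuple.
Qed.

Lemma basis_flagS i j : (i <= j)%N -> (basis_flag i <= basis_flag j)%VS.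
Proof.
move=> le; apply: sub_span => x; rewrite -(take_takel _ (le : (i.+1 <= j.+1)%N)).
exact: mem_take.
Qed.

Lemma mem_basis_flag (i : nat) p : (forall j : 'I_n, (i < j)%N -> p j = 0) ->
  phi (basis_comb e p) \in basis_flag i.
Proof.
move=> p0; rewrite phi_comb memv_suml // => j _; have [le | gt] := leqP j i.
  apply/memvZ/memv_span; rewrite -nth_basis_image -(nth_take _ (le : (j < i.+1)%N)).
  by rewrite mem_nth // size_take size_tuple; case: ifP.
by rewrite p0 // rmorph0 scale0r mem0v.
Qed.

Lemma take_basis_image i x : x \in take i.+1 basis_image ->
  exists2 j : 'I_n, (j <= i)%N & x = phi (e j).
Proof.
case/(nthP 0) => j; rewrite size_take size_tuple => lt.
have [ltn lti] : (j < n)%N /\ (j < i.+1)%N by move: lt; case: ifP; lia.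
rewrite nth_take // => <-; exists (Ordinal ltn) => //.
by rewrite -nth_basis_image.
Qed.
End FunctionField.

(** * The conditions defining Len *)

Local Open Scope classical_set_scope.

Theorem theorem1p46 (R : realType) (k : fieldType) (C : P1_cover k)
    (g n : nat) (a : n.-tuple int) :
  smooth C -> geom_integral C -> has_genus C g ->
  has_degree C n -> (2 <= n)%N ->
  is_scrollar C a ->
  has_all_degrees (ratfun k) ->
  [\/ exists p r : nat, [/\ prime p, (1 <= r)%N & n = (p ^ r)%N],
      exists p q : nat, [/\ prime p, prime q, p <> q & n = (p * q)%N]
    | n = 12%N] ->
  (\bigcup_(T in [set T | tower_type n T]) Len R n T) (scrollar_point R g a).
Proof.
move=> _ [gA _] genus [L [phi [phi_ff dimL]]] n2 [sa [e [f [He Hf Hfe]]]] _ cn.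
have dom0 := function_field_domain phi_ff.
(* From here on the degree is n + 1, so that index 0 exists. *)
case: n a n2 sa e f He Hf Hfe dimL cn => // n a n2 sa e f He Hf Hfe dimL cn.
have a_mono (i j : 'I_n.+1) : (i <= j)%N -> tnth a i <= tnth a j.
  move=> le; rewrite !(tnth_nth 0).
  by apply: (sorted_leq_nth le_trans lexx 0 sa); rewrite ?inE ?size_tuple.
have a0 : tnth a ord0 = 0.
  by apply: (min_scrollar_eq0 dom0 He Hf Hfe) => i; apply: a_mono.
have a_ge0 i : 0 <= tnth a i by rewrite -a0 a_mono.
have a_gt0 i : i != ord0 -> 0 < tnth a i.
  move=> i0; rewrite lt_neqAle a_ge0 andbT; apply: contra_neq i0 => ai.
  exact: (scrollar_eq0_unique dom0 He Hf Hfe a_ge0 gA (esym ai) a0).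
have sum_a : (\sum_i absz (tnth a i))%N = (g + n)%N.
  rewrite (genus_sum dom0 He Hf Hfe a_ge0 genus) !(bigD1 ord0 (P := xpredT)) //= a0 !add0n.
  rewrite (eq_bigr (fun i => (absz (tnth a i)).-1 + 1)%N); last first.
    by move=> i i0; have := a_gt0 i i0; lia.
  by rewrite big_split /= sum1_card cardC1 card_ord.
have [T [towT carT]] := flag_tower_type dimL (dim_basis_flag phi_ff He)
  (@basis_flagS _ _ _ phi _ e) cn.
(* If a_(i+j) > a_i + a_j, monotonicity extends this to all i' <= i, j' <= j and all indices from i
   + j on. So F_i F_j lies in F_(i+j-1), and the pair carries at a partial product of T. *)
have subadd (i j l : 'I_n.+1) : (0 < i)%N -> (0 < j)%N -> l = (i + j)%N :> nat ->
    no_overflow T i j -> tnth a l <= tnth a i + tnth a j.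
  move=> i0 j0 lij no; rewrite leNgt; apply/negP => lt.
  have ltn : (i + j < n.+1)%N by rewrite -lij.
  have [|s sT] := carT i j i0 j0 ltn.
    apply: prodv_span_subv => x y /take_basis_image[i' lei ->] /take_basis_image[j' lej ->].
    have [p ep] := combP He (e i' * e j').
    rewrite -rmorphM ep mem_basis_flag // => z; rewrite -lij => ltz.
    apply: (structure_constant_eq0 dom0 He Hf Hfe ep).
    apply: le_lt_trans (lerD (a_mono _ _ lei) (a_mono _ _ lej)) (lt_le_trans lt _).
    by apply: a_mono; lia.
  by rewrite /carry leqNgt => /negP; apply; apply: no_overflow_modn no sT.
exists T => //.
have D0 : (0 < 2 * (g + n.+1 - 1))%N by lia.
have D0R : 0 < (2 * (g + n.+1 - 1))%N%:R :> R by rewrite ltr0n.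
have pt i : scrollar_point R g a 0 i =
    (tnth a (lift ord0 i))%:~R / (2 * (g + n.+1 - 1))%N%:R.
  by rewrite mxE (tnth_nth 0).
split=> /=.
- under eq_bigr => i _ do rewrite pt.
  rewrite -mulr_suml -rmorph_sum /=.
  have -> : \sum_(i < n) tnth a (lift ord0 i) = (g + n)%N :> int.
    rewrite -sum_a big_ord_recl a0 add0n [RHS]raddf_sum /=.
    by apply: eq_bigr => i _; rewrite gez0_abs.
  rewrite natrM addnS subn1 /= invfM mulrCA -pmulrn divff ?mulr1 //.
  by rewrite pnatr_eq0; lia.
- by move=> i; rewrite pt divr_ge0 ?ler0z // ltW.
- by move=> i j le; rewrite !pt ler_pM2r ?invr_gt0 // ler_int a_mono.
- move=> i j l lij no; rewrite !pt -mulrDl ler_pM2r ?invr_gt0 // -rmorphD ler_int.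
  exact: subadd.
Qed.
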